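(* Let $0 < \varepsilon \leq 1/2$, $k$ be any positive integer, and $X \subseteq \mathbb{R}^d$ a dataset of $n$ points that is $(k, \varepsilon)$-irreducible. Then the algorithm Query-$k$-means$(X, k, \varepsilon)$ runs in time $O(nd k^5/\varepsilon^4)$ and with probability at least $1/4$ outputs a center set $C$ such that $\Phi(C, X) \leq (1 + \varepsilon) \cdot \Delta_k(X)$. Moreover, the number of same-cluster queries it uses is $O(k^5/\varepsilon^4)$.
   Context: $\Phi(C,Y)=\sum_{y\in Y}\min_{c\in C}\|y-c\|^2$; $\Delta_j(X)$ is the optimal $j$-means cost. $X$ is $(k,\varepsilon)$-irreducible iff $\Delta_{k-1}(X)\geq(1+\varepsilon)\Delta_k(X)$. A fixed optimal clustering $X_1,\dots,X_k$ is implicit; SameCluster$(x,y)$ queries whether $x,y$ lie in the same $X_i$. $D^2$-sampling w.r.t. $C$ samples $x\in X$ with probability $\Phi(C,\{x\})/\Phi(C,X)$ (uniform if $C=\emptyset$); $\mu(T)$ is the centroid of multiset $T$. Constants: $N=2^{12}k^3/\varepsilon^2$, $M=64k/\varepsilon$, $L=2^{23}k^2/\varepsilon^4$. Query-$k$-means$(X,k,\varepsilon)$: $R\leftarrow\emptyset$, $C\leftarrow\emptyset$; for $i=1$ to $k$: (3.1) $D^2$-sample a multiset $S$ of $N$ points w.r.t. $C$; (3.2) $s\leftarrow$ UncoveredCluster$(C,S,R)$; (3.3) $T\leftarrow$ UniformSample$(X,C,s)$; (3.4) if $|T|<M$ continue to next $i$; (3.5) $R\leftarrow R\cup\{s\}$;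 (3.6) $C\leftarrow C\cup\{\mu(T)\}$. Return $C$. UncoveredCluster$(C,S,R)$: initialize empty groups $S_1,\dots,S_k$; put the elements of $R$ one each into $S_1,\dots,S_{|R|}$; for each $s\in S$, if some $y$ in some $S_j$ satisfies SameCluster$(s,y)$, add $s$ to that $S_j$, else put $s$ into an empty group; let $S_i$ be the largest group with $i>|R|$; return the $s\in S_i$ with smallest $\Phi(C,\{s\})$. UniformSample$(X,C,s)$: $T\leftarrow\emptyset$; repeat $L$ times: $D^2$-sample $x$ w.r.t. $C$; if SameCluster$(s,x)$, add $x$ to multiset $T$ with probability $\frac{\varepsilon}{128}\cdot\frac{\Phi(C,\{s\})}{\Phi(C,\{x\})}$; return $T$. *)

(* Defs.v *)
From HB Require Import structures.
From mathcomp Require Import all_boot all_order all_algebra.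
From mathcomp Require Import all_classical all_reals.
From mathcomp Require Import ereal.

Set Implicit Arguments.
Unset Strict Implicit.
Unset Printing Implicit Defensive.
Import Order.TTheory GRing.Theory Num.Theory.
Local Open Scope classical_set_scope.
Local Open Scope ring_scope.

(* The norm `|v| of the library on 'rV[R]_d is the sup norm, whence this    *)
(* explicit squared Euclidean norm.                                         *)
Definition sqnorm (R : realType) (d : nat) (v : 'rV[R]_d) : R :=
  \sum_(j < d) v 0 j ^+ 2.

(* Extended-real valued: the minimum over an empty set of centers is +oo.   *)
Definition Phi (R : realType) (d : nat) (C Y : seq 'rV[R]_d) : \bar R :=
  (\sum_(y <- Y) \big[Order.min/+oo]_(c <- C) (sqnorm (y - c))%:E)%E.

Definition Delta (R : realType) (d : nat) (j : nat) (X : seq 'rV[R]_d) : \bar R :=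
  ereal_inf [set Phi C X | C in [set C : seq 'rV[R]_d | size C = j]].

Definition irreducible (R : realType) (d : nat) (k : nat) (eps : R)
    (X : seq 'rV[R]_d) : Prop :=
  ((1 + eps)%:E * Delta k X <= Delta (k - 1)%N X)%E.

(* A clustering X_1, ..., X_k of X is given by a labelling cl, with         *)
(* X_i = {x in X | cl x = i}.                                               *)
Definition cluster_of (R : realType) (d k : nat) (X : seq 'rV[R]_d)
    (cl : 'rV[R]_d -> 'I_k) (i : 'I_k) : seq 'rV[R]_d :=
  [seq x <- X | cl x == i].

Definition optimal_clustering (R : realType) (d k : nat) (X : seq 'rV[R]_d)
    (cl : 'rV[R]_d -> 'I_k) : Prop :=
  (\sum_(i < k) Delta 1 (cluster_of X cl i))%E = Delta k X.

(* Programs over points of type P, returning a value of type A.             *)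
(*   Tick c p   spends c elementary steps, then runs p;                     *)
(*   Ask x y f  queries SameCluster(x, y);                                  *)
(*   Coin p f   tosses a coin with probability p of true;                   *)
(*   Draw w f   draws from the list w of pairs (point, weight), with        *)
(*              probability proportional to the weights.                    *)
(* Programs are independent of the oracle, which is supplied by the         *)
(* interpretations prob, runtime and queries below.                         *)
Inductive prog (R : realType) (P A : Type) : Type :=
| Ret of A
| Tick of nat & prog R P A
| Ask of P & P & (bool -> prog R P A)
| Coin of R & (bool -> prog R P A)
| Draw of seq (P * R) & (P -> prog R P A).

Arguments Ret {R P A} _.
Arguments Tick {R P A} _ _.
Arguments Ask {R P A} _ _ _.
Arguments Coin {R P A} _ _.
Arguments Draw {R P A} _ _.

Fixpoint bind (R : realType) (P A B : Type) (p : prog R P A)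
    (g : A -> prog R P B) : prog R P B :=
  match p with
  | Ret a => g a
  | Tick c p' => Tick c (bind p' g)
  | Ask x y f => Ask x y (fun b => bind (f b) g)
  | Coin r f => Coin r (fun b => bind (f b) g)
  | Draw w f => Draw w (fun x => bind (f x) g)
  end.

Notation "'let*' x := p 'in' q" := (bind p (fun x => q))
  (at level 200, x name, p at level 200, q at level 200).

Section Interpretation.
Context {R : realType} {P A : Type} (same : P -> P -> bool).

Fixpoint prob (E : A -> bool) (p : prog R P A) : R :=
  match p with
  | Ret a => (E a)%:R
  | Tick _ p' => prob E p'
  | Ask x y f => prob E (f (same x y))
  | Coin r f => r * prob E (f true) + (1 - r) * prob E (f false)
  | Draw w f =>
      \sum_(xr <- w) xr.2 / (\sum_(yr <- w) yr.2) * prob E (f xr.1)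
  end.

(* Worst-case running time over all random outcomes. A query and a coin     *)
(* toss take one step, a draw from m weights takes m steps.                 *)
Fixpoint runtime (p : prog R P A) : nat :=
  match p with
  | Ret _ => 0
  | Tick c p' => c + runtime p'
  | Ask x y f => (runtime (f (same x y))).+1
  | Coin _ f => (maxn (runtime (f true)) (runtime (f false))).+1
  | Draw w f => size w + \max_(xr <- w) runtime (f xr.1)
  end%N.

Fixpoint queries (p : prog R P A) : nat :=
  match p with
  | Ret _ => 0
  | Tick _ p' => queries p'
  | Ask x y f => (queries (f (same x y))).+1
  | Coin _ f => maxn (queries (f true)) (queries (f false))
  | Draw w f => \max_(xr <- w) queries (f xr.1)
  end%N.

End Interpretation.

Section Algorithm.
Variables (R : realType) (d : nat).
Local Notation point := 'rV[R]_d.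
Local Notation prg := (prog R point).

(* Cost model (real RAM): one step per operation or comparison on scalars,  *)
(* d steps per coordinatewise operation on points, one step per iteration   *)
(* of a loop.                                                               *)
Definition scal {A : Type} (a : A) : prg A := Tick 1 (Ret a).
Definition vect {A : Type} (a : A) : prg A := Tick d (Ret a).

Definition ask (x y : point) : prg bool := Ask x y Ret.
Definition coin (r : R) : prg bool := Coin r Ret.
Definition draw (w : seq (point * R)) : prg point := Draw w Ret.

Fixpoint foldM {S B : Type} (f : B -> S -> prg B) (b : B) (s : seq S) : prg B :=
  if s is x :: s' then Tick 1 (let* b' := f b x in foldM f b' s') else Ret b.

Fixpoint iterM {B : Type} (m : nat) (f : B -> prg B) (b : B) : prg B :=
  if m is m'.+1 then Tick 1 (let* b' := f b in iterM m' f b') else Ret b.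

(* ||x - y||^2: d subtractions, d multiplications, d additions.             *)
Definition sqdistM (x y : point) : prg R :=
  let* v := vect (x - y) in
  let* v2 := vect (\row_j (v 0 j ^+ 2)) in
  vect (\sum_(j < d) v2 0 j).

(* Phi(C, {x}). For C empty the value is the constant 1 instead of +oo:     *)
(* D^2-sampling is then uniform and Phi(C, {s}) / Phi(C, {x}) equals 1.     *)
Definition phiM (C : seq point) (x : point) : prg R :=
  if C is c :: C' then
    let* e := sqdistM x c in
    foldM (fun m c' => let* e' := sqdistM x c' in scal (Order.min m e')) e C'
  else scal 1.

(* D^2-sampling of one point of X with respect to C; uniform when all the   *)
(* weights vanish, i.e., when Phi(C, X) = 0.                                *)
Definition d2sample (X C : seq point) : prg point :=
  let* w := foldM (fun w x => let* e := phiM C x in Ret ((x, e) :: w)) [::] X in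
  let* tot := foldM (fun t xe => scal (t + xe.2)) 0 w in
  let* isz := scal (tot == 0) in
  if isz then Tick (size w) (draw [seq (xe.1, 1) | xe <- w]) else draw w.

Definition d2samples (X C : seq point) (m : nat) : prg (seq point) :=
  iterM m (fun S => let* x := d2sample X C in Ret (x :: S)) [::].

(* Adds s to the group containing a point of its cluster, or to the first   *)
(* empty group. The nonempty groups always come first, and one query per    *)
(* nonempty group is enough as each group lies in a single cluster.         *)
Fixpoint insertM (s : point) (G : seq (seq point)) : prg (seq (seq point)) :=
  match G with
  | [::] => Ret [::]
  | [::] :: G' => scal ([:: s] :: G')
  | (y :: g) :: G' =>
      let* b := ask s y in
      if b then scal ((s :: y :: g) :: G')
      else let* G'' := insertM s G' in scal ((y :: g) :: G'')
  end.

Definition largestM (G : seq (seq point)) : prg (seq point) :=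
  foldM (fun best g =>
    Tick (size best + size g)
      (scal (if (size best < size g)%N then g else best))) [::] G.

Definition closestM (C : seq point) (g : seq point) : prg (option point) :=
  if g is s0 :: g' then
    let* e0 := phiM C s0 in
    let* se := foldM (fun se s =>
                 let* e := phiM C s in
                 scal (if e < se.2 then (s, e) else se)) (s0, e0) g' in
    Ret (Some se.1)
  else Ret None.

(* Returns None if every group of index > |Rs| is empty, i.e., if S only    *)
(* meets clusters that already have a representative in Rs.                 *)
Definition uncovered_cluster (k : nat) (C S Rs : seq point) :
    prg (option point) :=
  let* G0 := Tick k (Ret ([seq [:: y] | y <- Rs] ++ nseq (k - size Rs) [::])) in
  let* G := foldM (fun G s => insertM s G) G0 S in
  let* g := largestM (drop (size Rs) G) in
  closestM C g.

Definition constN (k : nat) (eps : R) : nat :=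
  `|Num.ceil (2 ^+ 12 * k%:R ^+ 3 / eps ^+ 2)|%N.
Definition constM (k : nat) (eps : R) : R := 64 * k%:R / eps.
Definition constL (k : nat) (eps : R) : nat :=
  `|Num.ceil (2 ^+ 23 * k%:R ^+ 2 / eps ^+ 4)|%N.

Definition uniform_sample (k : nat) (eps : R) (X C : seq point) (s : point) :
    prg (seq point) :=
  iterM (constL k eps) (fun T =>
    let* x := d2sample X C in
    let* b := ask s x in
    if b then
      let* es := phiM C s in
      let* ex := phiM C x in
      let* r := Tick 4 (Ret (Order.min 1 (eps / 128 * (es / ex)))) in
      let* keep := coin r in
      Ret (if keep then x :: T else T)
    else Ret T) [::].

Definition centroidM (T : seq point) : prg point :=
  let* v := foldM (fun v x => vect (v + x)) 0 T in
  let* m := Tick (size T) (Ret ((size T)%:R : R)) in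
  vect (m^-1 *: v).

Definition query_kmeans (X : seq point) (k : nat) (eps : R) : prg (seq point) :=
  let* RC := iterM k (fun RC : seq point * seq point =>
    let* S := d2samples X RC.2 (constN k eps) in
    let* os := uncovered_cluster k RC.2 S RC.1 in
    if os is Some s then
      let* T := uniform_sample k eps X RC.2 s in
      let* few := Tick (size T) (scal ((size T)%:R < constM k eps)) in
      if few then Ret RC
      else let* c := centroidM T in Ret (rcons RC.1 s, rcons RC.2 c)
    else Ret RC) ([::], [::]) in
  Ret RC.2.

End Algorithm.

Definition same_cluster (R : realType) (d k : nat) (cl : 'rV[R]_d -> 'I_k)
    (x y : 'rV[R]_d) : bool := cl x == cl y.

Section Sampling.
Variables (R : realType) (d : nat).
Local Notation point := 'rV[R]_d.
Local Notation prg := (prog R point).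

(* p deterministically returns a.                                           *)
Definition computes {A : Type} (p : prg A) (a : A) : Prop :=
  forall same B (E : B -> bool) (g : A -> prg B),
    prob same E (bind p g) = prob same E (g a).

Lemma bindA A B D (p : prg A) (f : A -> prg B) (g : B -> prg D) same E :
  prob same E (bind (bind p f) g) = prob same E (bind p (fun a => bind (f a) g)).
Proof.
elim: p => [a|c p IH|x y h IH|r h IH|w h IH] //=; rewrite ?IH //.
by apply: eq_bigr => i _; rewrite IH.
Qed.

Lemma computes_bind A B (p : prg A) a (f : A -> prg B) b :
  computes p a -> computes (f a) b -> computes (bind p f) b.
Proof. by move=> hp hf same D E g; rewrite bindA hp hf. Qed.

Lemma computes_fold S B (f : B -> S -> prg B) (h : B -> S -> B) s :
  (forall b x, computes (f b x) (h b x)) ->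
  forall b, computes (foldM f b s) (foldl h b s).
Proof.
move=> H; elim: s => [|x s IH] b //= same D E g /=.
by rewrite bindA H IH.
Qed.

Lemma sqdistM_computes (x y : point) : computes (sqdistM x y) (sqnorm (x - y)).
Proof.
move=> same B E g /=; congr (prob _ _ (g _)).
by apply: eq_bigr => j _; rewrite mxE.
Qed.

Lemma Phi1 (C : seq point) x :
  Phi C [:: x] = (\big[Order.min/+oo]_(c <- C) (sqnorm (x - c))%:E)%E.
Proof. by rewrite /Phi big_seq1. Qed.

Lemma phiM_computes c C (x : point) :
  computes (phiM (c :: C) x) (fine (Phi (c :: C) [:: x])).
Proof.
have -> : fine (Phi (c :: C) [:: x]) =
    foldl (fun m c' => Order.min m (sqnorm (x - c'))) (sqnorm (x - c)) C.
  rewrite Phi1 big_cons; elim: C (sqnorm _) => [|c' C IH] m /=.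
    by rewrite big_nil miney.
  by rewrite big_cons Order.TotalTheory.minA -EFin_min IH.
apply: computes_bind; first exact: sqdistM_computes.
apply: computes_fold => m c' same B E g; rewrite bindA sqdistM_computes //.
Qed.

Lemma sqnorm_ge0 (v : point) : 0 <= sqnorm v.
Proof. by apply: sumr_ge0 => j _; rewrite sqr_ge0. Qed.

Lemma Phi_fin c C (Y : seq point) :
  Phi (c :: C) Y = (\sum_(y <- Y) fine (Phi (c :: C) [:: y]))%:E.
Proof.
rewrite -sumEFin /Phi; apply: eq_bigr => y _.
rewrite big_seq1 fineK // big_cons.
elim: C (sqnorm _) => [|c' C IH] m /=; first by rewrite big_nil miney.
by rewrite big_cons Order.TotalTheory.minA -EFin_min IH.
Qed.

Lemma foldl_revmap S B (f : S -> B) s acc :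
  foldl (fun w y => f y :: w) acc s = rev (map f s) ++ acc.
Proof. by elim: s acc => //= y s IH acc; rewrite IH rev_cons cat_rcons. Qed.

Lemma foldl_sum S (v : seq (S * R)) t :
  foldl (fun t xe => t + xe.2) t v = t + \sum_(yr <- v) yr.2.
Proof.
by elim: v t => [|y v IH] t /=; rewrite ?big_nil ?addr0 // big_cons IH addrA.
Qed.

(* Outside the degenerate cases, d2sample is the                            *)
(* D^2-sampling distribution x |-> Phi(C, {x}) / Phi(C, X).                 *)
Lemma d2sample_prob same (X C : seq point) x : uniq X -> x \in X -> C != [::] ->
  Phi C X != 0%E ->
  prob same (pred1 x) (d2sample X C) = fine (Phi C [:: x]) / fine (Phi C X).
Proof.
case: C => // c C uX xX _ nz.
have nz' : (fine (Phi (c :: C) X) == 0) = false.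
  by apply/negbTE; move: nz; rewrite Phi_fin eqe.
rewrite /d2sample (@computes_fold _ _ _
  (fun w y => (y, fine (Phi (c :: C) [:: y])) :: w)); last first.
  by move=> w y same' B E g; rewrite bindA phiM_computes.
set v := rev [seq (y, fine (Phi (c :: C) [:: y])) | y <- X].
have -> : foldl (fun w y => (y, fine (Phi (c :: C) [:: y])) :: w) [::] X = v.
  by rewrite (foldl_revmap (fun y => (y, fine (Phi (c :: C) [:: y])))) cats0.
have pv : perm_eq v [seq (y, fine (Phi (c :: C) [:: y])) | y <- X].
  by rewrite perm_rev.
have Hv : \sum_(yr <- v) yr.2 = fine (Phi (c :: C) X).
  by rewrite Phi_fin (perm_big _ pv) /= big_map.
rewrite (@computes_fold _ _ _ (fun t xe => t + xe.2)) //.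
have -> : foldl (fun t xe => t + xe.2) 0 v = fine (Phi (c :: C) X).
  by rewrite foldl_sum add0r.
rewrite /= nz' /= Hv (perm_big _ pv) /= big_map.
rewrite (bigD1_seq x) //= eqxx mulr1 big1 ?addr0 // => y /negbTE ->.
by rewrite mulr0.
Qed.

Lemma d2sample_prob0 same (X : seq point) x : uniq X -> x \in X ->
  prob same (pred1 x) (d2sample X [::]) = (size X)%:R^-1.
Proof.
move=> uX xX.
rewrite /d2sample (@computes_fold _ _ _ (fun w y => (y, 1) :: w)) //.
set v := rev [seq (y, 1 : R) | y <- X].
have -> : foldl (fun w y => (y, 1) :: w) [::] X = v.
  by rewrite (foldl_revmap (fun y => (y, 1))) cats0.
have pv : perm_eq v [seq (y, 1) | y <- X] by rewrite perm_rev.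
have Hv : \sum_(yr <- v) yr.2 = (size X)%:R.
  by rewrite (perm_big _ pv) /= big_map /= big_const_seq count_predT iter_addr addr0.
rewrite (@computes_fold _ _ _ (fun t xe => t + xe.2)) //.
have -> : foldl (fun t xe => t + xe.2) 0 v = (size X)%:R.
  by rewrite foldl_sum add0r.
have -> : ((size X)%:R == 0 :> R) = false by rewrite pnatr_eq0; case: (X) xX.
rewrite /= Hv (perm_big _ pv) /= big_map.
rewrite (bigD1_seq x) //= eqxx mulr1 mul1r big1 ?addr0 // => y /negbTE ->.
by rewrite mulr0.
Qed.
End Sampling.

(* Main.v *)
Require Import Defs.
From mathcomp Require Import all_boot all_order all_algebra.
From mathcomp Require Import all_classical all_reals.
From mathcomp Require Import ereal.
From mathcomp Require Import ring lra zify.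
Import Order.TTheory GRing.Theory Num.Theory.
Set Implicit Arguments.
Unset Strict Implicit.
Unset Printing Implicit Defensive.
Local Open Scope ring_scope.

(** Call a state of the algorithm good if the representatives lie in distinct
optimal clusters and every center c is close to the centroid mu_j of the
cluster X_j it stands for: |X_j| ||c - mu_j||^2 <= (eps / 16) Delta_1(X_j).
The event Phi(C, X) <= (1 + eps) Delta_k(X) is never lost once it holds, and a
good state covering all clusters satisfies it. In a good state without it,
the uncovered clusters carry a fraction of at least 5 eps / 8 of Phi(C, X), and
irreducibility separates the optimal centroids so well that every point of an
uncovered cluster costs at least eps / 32 times the average of its cluster.

Chebyshev's inequality then shows that the N samples single out an uncovered
cluster of cost at least eps / (8 k) Phi(C, X) together with a point s of cost
at most four times the average. For such an s no acceptance probability is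
truncated at 1, so each round of UniformSample adds each point of the cluster
with one and the same probability alpha. The size of T and the vector
sum_(x in T) (x - mu_j) are sums of martingale increments; with
E = L alpha |X_j| >= 256 k / eps the former is at least E / 2 and the latter
has squared norm at most (eps / 16) (E / 2)^2 Delta_1(X_j) / |X_j|, which makes
the mean of T a close center. The choice of s fails with probability at most
3 / (16 k) and that of T with probability at most 5 / (16 k); a union bound over
the k iterations gives success with probability at least 1 / 2. *)

(** * Expectations and Hoare triples for programs *)

Section ProgramLogic.
Variables (R : realType) (d : nat).
Local Notation point := 'rV[R]_d.
Local Notation prg := (prog R point).
Variable same : point -> point -> bool.

(** Linear in [f] for every program, because nothing here requires the probabilities to sum to 1.
    Monotonicity and the value on constants need [valid]. *)
Fixpoint expect {A : Type} (f : A -> R) (p : prg A) : R :=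
  match p with
  | Ret a => f a
  | Tick _ p' => expect f p'
  | Ask x y g => expect f (g (same x y))
  | Coin r g => r * expect f (g true) + (1 - r) * expect f (g false)
  | Draw w g =>
      \sum_(xr <- w) xr.2 / (\sum_(yr <- w) yr.2) * expect f (g xr.1)
  end.

(** Besides the postcondition, this demands that every coin and draw met on the way is a genuine
    probability distribution. All points of a drawn list are followed, also those of weight 0, which
    matches the worst-case maxima in [runtime] and [queries]. *)
Fixpoint valid {A : Type} (Q : A -> Prop) (p : prg A) : Prop :=
  match p with
  | Ret a => Q a
  | Tick _ p' => valid Q p'
  | Ask x y g => valid Q (g (same x y))
  | Coin r g => [/\ 0 <= r <= 1, valid Q (g true) & valid Q (g false)]
  | Draw w g =>
      0 < \sum_(yr <- w) yr.2 /\
      forall xr, xr \in w -> 0 <= xr.2 /\ valid Q (g xr.1)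
  end.

Lemma prob_expect (A : Type) (E : A -> bool) (p : prg A) :
  prob same E p = expect (fun a => (E a)%:R) p.
Proof.
elim: p => [a|c p IH|x y g IH|r g IH|w g IH] //=; rewrite ?IH //.
by apply: eq_bigr => i _; rewrite IH.
Qed.

Lemma expect_bind (A B : Type) (p : prg A) (g : A -> prg B) f :
  expect f (bind p g) = expect (fun a => expect f (g a)) p.
Proof.
elim: p => [a|c p IH|x y h IH|r h IH|w h IH] //=; rewrite ?IH //.
by apply: eq_bigr => i _; rewrite IH.
Qed.

Lemma expectD (A : Type) (f g : A -> R) p :
  expect (fun a => f a + g a) p = expect f p + expect g p.
Proof.
elim: p => [a|c p IH|x y h IH|r h IH|w h IH] //=; rewrite ?IH //.
  by ring.
by rewrite -big_split /=; apply: eq_bigr => i _; rewrite IH mulrDr.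
Qed.

Lemma expectZ (A : Type) c (f : A -> R) p :
  expect (fun a => c * f a) p = c * expect f p.
Proof.
elim: p => [a|c' p IH|x y h IH|r h IH|w h IH] //=; rewrite ?IH //.
  by ring.
by rewrite mulr_sumr; apply: eq_bigr => i _; rewrite IH mulrCA.
Qed.

Lemma expect_sum (A I : Type) (s : seq I) (P : pred I) (F : I -> A -> R) p :
  expect (fun a => \sum_(i <- s | P i) F i a) p =
  \sum_(i <- s | P i) expect (F i) p.
Proof.
elim: s => [|i s IH].
  (* Linearity alone gives the expectation of 0, so [valid] is avoided by writing 0 as 0 times an
     expectation. *)
  rewrite big_nil -[RHS](mul0r (expect (fun=> 1) p)) -expectZ.
  by congr expect; apply/funext => a; rewrite big_nil mul0r.
rewrite big_cons -IH; case: ifPn => Pi; last first.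
  by congr expect; apply/funext => a; rewrite big_cons (negbTE Pi).
rewrite -expectD.
by congr expect; apply/funext => a; rewrite big_cons Pi.
Qed.

Lemma eq_expect (A : Type) (f g : A -> R) p : f =1 g -> expect f p = expect g p.
Proof. by move=> fg; congr expect; apply/funext. Qed.

Lemma expect_le (A : Type) Q (f g : A -> R) p : valid Q p ->
  (forall a, Q a -> f a <= g a) -> expect f p <= expect g p.
Proof.
move=> vp fg; elim: p vp => [a|c p IH|x y h IH|r h IH|w h IH] //=.
- exact: fg.
- by move=> ?; exact: IH.
- by case=> /andP[r0 r1] v1 v2; rewrite lerD // ler_wpM2l ?IH ?subr_ge0.
- case=> wp vw; rewrite big_seq [leRHS]big_seq; apply: ler_sum => xr /vw[xr0 v].
  by rewrite ler_wpM2l ?IH // divr_ge0 // ltW.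
Qed.

Lemma expect_cst (A : Type) Q c (p : prg A) : valid Q p -> expect (fun=> c) p = c.
Proof.
elim: p => [a|c' p IH|x y h IH|r h IH|w h IH] //=.
- exact: IH.
- by case=> _ v1 v2; rewrite !IH //; ring.
- case=> wp vw; rewrite big_seq.
  rewrite (eq_bigr (fun xr => xr.2 / (\sum_(yr <- w) yr.2) * c)); last first.
    by move=> xr /vw[_ /IH ->].
  rewrite -big_seq.
  by rewrite -!mulr_suml divff ?mul1r // gt_eqF.
Qed.

(** This removes deterministic subroutines from expectations: their specifications have a
    postcondition of the form [eq a]. *)
Lemma expect_det (A : Type) (f : A -> R) a p : valid (eq a) p -> expect f p = f a.
Proof.
move=> v; rewrite -(expect_cst (f a) v); apply/eqP; rewrite eq_le.
by apply/andP; split; apply: (expect_le v) => b <-.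
Qed.

Lemma valid_imp (A : Type) (Q Q' : A -> Prop) p :
  (forall a, Q a -> Q' a) -> valid Q p -> valid Q' p.
Proof.
move=> QQ; elim: p => [a|c' p IH|x y h IH|r h IH|w h IH] //=.
- exact: QQ.
- exact: IH.
- by case=> ? ? ?; split=> //; apply: IH.
- by case=> ? H; split=> // xr /H[? ?]; split=> //; apply: IH.
Qed.

Lemma valid_bind (A B : Type) (Q : A -> Prop) (Q' : B -> Prop) p (g : A -> prg B) :
  valid Q p -> (forall a, Q a -> valid Q' (g a)) -> valid Q' (bind p g).
Proof.
move=> v H; elim: p v => [a|c' p IH|x y h IH|r h IH|w h IH] //=.
- exact: H.
- exact: IH.
- by case=> ? ? ?; split=> //; apply: IH.
- by case=> ? Hw; split=> // xr /Hw[? ?]; split=> //; apply: IH.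
Qed.

(** Turns validity of a whole iteration into validity of what remains after its first stage, so that
    the remainder has nonnegative expectations even where the stage failed. *)
Lemma valid_bind_inv (A B : Type) (Q : B -> Prop) p (g : A -> prg B) :
  valid Q (bind p g) -> valid (fun a => valid Q (g a)) p.
Proof.
elim: p => [a|c' p IH|x y h IH|r h IH|w h IH] //=.
- exact: IH.
- by case=> ? ? ?; split=> //; apply: IH.
- by case=> ? Hw; split=> // xr /Hw[? ?]; split=> //; apply: IH.
Qed.

Lemma valid_and (A : Type) (Q Q' : A -> Prop) p :
  valid Q p -> valid Q' p -> valid (fun a => Q a /\ Q' a) p.
Proof.
elim: p => [a|c' p IH|x y h IH|r h IH|w h IH] //=.
- exact: IH.
- by case=> ? ? ? [_ ? ?]; split=> //; apply: IH.
- case=> ? H [_ H']; split=> // xr xw; have [? ?] := H xr xw.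
  by have [_ ?] := H' xr xw; split=> //; apply: IH.
Qed.

Lemma expect_ge0 (A : Type) Q (f : A -> R) p : valid Q p ->
  (forall a, 0 <= f a) -> 0 <= expect f p.
Proof.
by move=> v f0; rewrite -(expect_cst 0 v); apply: (expect_le v).
Qed.

Lemma runtime_bind (A B : Type) (Q : A -> Prop) p (g : A -> prg B) t : valid Q p ->
  (forall a, Q a -> (runtime same (g a) <= t)%N) ->
  (runtime same (bind p g) <= runtime same p + t)%N.
Proof.
move=> v H; elim: p v => [a|c' p IH|x y h IH|r h IH|w h IH] //=.
- exact: H.
- by move=> /IH; rewrite -addnA leq_add2l.
- by move=> /IH.
- case=> _ /IH h1 /IH h2; rewrite addSn ltnS geq_max.
  by rewrite (leq_trans h1) ?(leq_trans h2) // leq_add2r ?leq_maxl ?leq_maxr.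
- case=> _ Hw; rewrite -addnA leq_add2l; apply/bigmax_leqP_seq => xr xw _.
  have [_ /IH h1] := Hw _ xw; apply: leq_trans h1 _; rewrite leq_add2r.
  exact: (@leq_bigmax_seq _ _ predT (fun xr => runtime same (h xr.1))).
Qed.

Lemma queries_bind (A B : Type) (Q : A -> Prop) p (g : A -> prg B) t : valid Q p ->
  (forall a, Q a -> (queries same (g a) <= t)%N) ->
  (queries same (bind p g) <= queries same p + t)%N.
Proof.
move=> v H; elim: p v => [a|c' p IH|x y h IH|r h IH|w h IH] //=.
- exact: H.
- by move=> /IH.
- case=> _ /IH h1 /IH h2; rewrite geq_max.
  by rewrite (leq_trans h1) ?(leq_trans h2) // leq_add2r ?leq_maxl ?leq_maxr.
- case=> _ Hw; apply/bigmax_leqP_seq => xr xw _.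
  have [_ /IH h1] := Hw _ xw; apply: leq_trans h1 _; rewrite leq_add2r.
  exact: (@leq_bigmax_seq _ _ predT (fun xr => queries same (h xr.1))).
Qed.

(** Correctness, time and queries are bundled so that each subroutine is traversed only once. *)
Definition spec {A : Type} (Q : A -> Prop) (t q : nat) (p : prg A) : Prop :=
  [/\ valid Q p, (runtime same p <= t)%N & (queries same p <= q)%N].

Lemma spec_valid (A : Type) (Q : A -> Prop) t q p : spec Q t q p -> valid Q p.
Proof. by case. Qed.

Lemma spec_ret (A : Type) (Q : A -> Prop) t q a : Q a -> spec Q t q (Ret a).
Proof. by []. Qed.

Lemma spec_tick (A : Type) (Q : A -> Prop) c t q p :
  spec Q t q p -> spec Q (c + t) q (Tick c p).
Proof. by case=> v rt qr; split=> //=; rewrite leq_add2l. Qed.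

Lemma spec_bind (A B : Type) (Q : A -> Prop) (Q' : B -> Prop) t1 q1 t2 q2 p g :
  spec Q t1 q1 p -> (forall a, Q a -> spec Q' t2 q2 (g a)) ->
  spec Q' (t1 + t2) (q1 + q2) (bind p g).
Proof.
case=> v rt qr H; split.
- by apply: valid_bind v _ => a /H[].
- apply: leq_trans (runtime_bind v _) (leq_add rt (leqnn t2)).
  by move=> a /H[].
- apply: leq_trans (queries_bind v _) (leq_add qr (leqnn q2)).
  by move=> a /H[].
Qed.

Lemma spec_weaken (A : Type) (Q Q' : A -> Prop) t q t' q' p :
  spec Q t q p -> (forall a, Q a -> Q' a) -> (t <= t')%N -> (q <= q')%N ->
  spec Q' t' q' p.
Proof.
case=> v rt qr QQ tt qq; split; first exact: valid_imp v.
  exact: leq_trans tt.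
exact: leq_trans qq.
Qed.

Lemma spec_foldM (S B : Type) (f : B -> S -> prg B) (I : seq S -> B -> Prop)
    t q s b :
  (forall x s' b', I (x :: s') b' -> spec (I s') t q (f b' x)) ->
  I s b -> spec (I [::]) (size s * t.+1) (size s * q) (foldM f b s).
Proof.
move=> H; elim: s b => [|x s IH] b Ib //.
rewrite /= !mulSn addSn -add1n; apply: spec_tick.
by apply: spec_bind (H _ _ _ Ib) _ => b' /IH.
Qed.

Lemma spec_foldM_foldl (S B : Type) (f : B -> S -> prg B) (h : B -> S -> B) t q s b :
  (forall b x, spec (eq (h b x)) t q (f b x)) ->
  spec (eq (foldl h b s)) (size s * t.+1) (size s * q) (foldM f b s).
Proof.
move=> H.
(* The invariant says that folding the remaining elements from the current accumulator still leads
   to the final value. *)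
have := @spec_foldM _ _ f (fun s' b' => foldl h b s = foldl h b' s') t q s b.
apply=> // x s' b' E; apply: spec_weaken (H b' x) _ _ _ => //.
by move=> _ <-.
Qed.

Lemma spec_iterM (B : Type) (f : B -> prg B) (I : nat -> B -> Prop) t q m b :
  (forall i b', (i < m)%N -> I i b' -> spec (I i.+1) t q (f b')) ->
  I 0 b -> spec (I m) (m * t.+1) (m * q) (Defs.iterM m f b).
Proof.
elim: m I b => [|m IH] I b H Ib //.
rewrite /= !mulSn addSn -add1n; apply: spec_tick.
apply: spec_bind (H _ _ _ Ib) _ => // b' Ib'.
by apply: (IH (fun i => I i.+1)) => // i b'' im; apply: H.
Qed.

(* Chebyshev's argument: the increments h b' - h b - q are martingale       *)
(* differences, so their second moments add up.                             *)
Lemma expect_iterM_variance (B : Type) (f : B -> prg B) (h : B -> R)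
    (I : B -> Prop) q v m b :
  (forall b', I b' -> valid I (f b')) ->
  (forall b', I b' -> expect (fun b'' => h b'' - h b' - q) (f b') = 0) ->
  (forall b', I b' -> expect (fun b'' => (h b'' - h b' - q) ^+ 2) (f b') <= v) ->
  I b -> expect (fun b' => (h b' - h b - m%:R * q) ^+ 2) (Defs.iterM m f b) <= m%:R * v.
Proof.
move=> vf mean var Ib.
have vit j b' : I b' -> valid I (Defs.iterM j f b').
  by elim: j b' => //= j IH b' Ib'; apply: valid_bind (vf _ Ib') IH.
(* The vanishing mean is carried through the induction together with the variance, since it kills
   the cross term. *)
suff: expect (fun b' => h b' - h b - m%:R * q) (Defs.iterM m f b) = 0 /\
  expect (fun b' => (h b' - h b - m%:R * q) ^+ 2) (Defs.iterM m f b) <= m%:R * v.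
  by case.
elim: m b Ib => [|m IH] b Ib /=; first by rewrite !mul0r !subrr expr2 mul0r.
rewrite !expect_bind; split.
- rewrite -[RHS](mean _ Ib); apply/eqP; rewrite eq_le.
  have E b' : I b' -> expect (fun a => h a - h b - m.+1%:R * q) (Defs.iterM m f b')
      = h b' - h b - q.
    move=> Ib'; have [IH1 _] := IH _ Ib'.
    rewrite -[RHS]add0r -IH1 -(expect_cst (h b' - h b - q) (vit m _ Ib')).
    rewrite -expectD; apply: eq_expect => a; rewrite -natr1; ring.
  by apply/andP; split; apply: expect_le (vf _ Ib) _ => b' Ib'; rewrite E.
- have E b' : I b' -> expect (fun a => (h a - h b - m.+1%:R * q) ^+ 2) (Defs.iterM m f b')
      <= (h b' - h b - q) ^+ 2 + m%:R * v.
    move=> Ib'; have [IH1 IH2] := IH _ Ib'.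
    (* With [y] the first increment and z the sum of the others, (y + z)^2 = z^2 + y^2 + 2 y z. A
       zero on the right is rewritten as 2 y times the mean of z, so that both sides become
       expectations. *)
    set y := h b' - h b - q; rewrite addrC -[X in _ <= _ + X]addr0.
    rewrite -(mulr0 (2 * y)) -IH1 -expectZ.
    rewrite -(expect_cst (y ^+ 2) (vit m _ Ib')) -expectD.
    have -> : expect (fun a => (h a - h b - m.+1%:R * q) ^+ 2) (Defs.iterM m f b') =
      expect (fun a => (h a - h b' - m%:R * q) ^+ 2 +
         (y ^+ 2 + 2 * y * (h a - h b' - m%:R * q))) (Defs.iterM m f b').
      apply: eq_expect => a; rewrite /y -natr1; ring.
    by rewrite [leLHS]expectD lerD2r.
  apply: le_trans (expect_le (vf _ Ib) E) _.
  rewrite expectD (expect_cst _ (vf _ Ib)) -natr1 mulrDl mul1r addrC lerD2l.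
  exact: var.
Qed.

End ProgramLogic.

(** * The D^2 weights *)

Section Weight.
Variables (R : realType) (d : nat).
Local Notation point := 'rV[R]_d.

(* For C empty the value 1 makes D^2-sampling uniform, as in phiM. *)
Definition weight (C : seq point) (x : point) : R :=
  if C is [::] then 1 else fine (Phi C [:: x]).

Lemma weight_cons c C x :
  weight (c :: C) x =
  foldl (fun m c' => Order.min m (sqnorm (x - c'))) (sqnorm (x - c)) C.
Proof.
rewrite /weight Phi1 big_cons; elim: C (sqnorm _) => [|c' C IH] m /=.
  by rewrite big_nil miney.
by rewrite big_cons Order.TotalTheory.minA -EFin_min IH.
Qed.

Lemma weight_attained C x : C != [::] ->
  exists2 c, c \in C & weight C x = sqnorm (x - c).
Proof.
case: C => // c0 C _; rewrite weight_cons.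
elim: C c0 => [|c C IH] c0 /=; first by exists c0; rewrite ?mem_head.
case: (leP (sqnorm (x - c0)) (sqnorm (x - c))) => _.
  have [c1 c1C ->] := IH c0; exists c1 => //.
  by move: c1C; rewrite !inE => /orP[->//|->]; rewrite !orbT.
have [c1 c1C ->] := IH c; exists c1 => //.
by rewrite inE c1C orbT.
Qed.

Lemma weight_le C x c : c \in C -> weight C x <= sqnorm (x - c).
Proof.
case: C => // c0 C; rewrite weight_cons.
have mono a b s : a <= b ->
    foldl (fun m c' => Order.min m (sqnorm (x - c'))) a s <=
    foldl (fun m c' => Order.min m (sqnorm (x - c'))) b s.
  elim: s a b => //= c' s IH a b ab; apply: IH.
  by rewrite le_min !ge_min ab lexx !orbT.
have bound a s : foldl (fun m c' => Order.min m (sqnorm (x - c'))) a s <= a.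
  elim: s a => //= c' s IH a; apply: le_trans (IH _) _.
  by rewrite ge_min lexx.
rewrite inE => /orP[/eqP->//|].
elim: C (sqnorm (x - c0)) => //= c' C IH a; rewrite inE => /orP[/eqP->|/IH//].
by apply: le_trans (bound _ _) _; rewrite ge_min lexx orbT.
Qed.

Lemma weight_ge0 C x : 0 <= weight C x.
Proof.
have [->|C0] := eqVneq C [::]; first exact: ler01.
by have [c _ ->] := weight_attained x C0; exact: sqnorm_ge0.
Qed.

Lemma Phi_weight C (Y : seq point) : C != [::] ->
  Phi C Y = (\sum_(y <- Y) weight C y)%:E.
Proof. by case: C => // c C _; rewrite Phi_fin. Qed.

End Weight.

(** * Specifications of the subroutines *)

Section Subroutines.
Variables (R : realType) (d k : nat) (cl : 'rV[R]_d -> 'I_k).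
Hypotheses (d_gt0 : (0 < d)%N) (k_gt0 : (0 < k)%N).
Local Notation point := 'rV[R]_d.
Local Notation prg := (prog R point).
Local Notation same := (same_cluster cl).
Local Notation spec := (spec same).

(** The rule for [bind] read from the total budget: the continuation receives whatever time and
    queries the first program leaves. *)
Lemma spec_seq (A B : Type) (Q : A -> Prop) (Q' : B -> Prop) t1 q1 t q p g :
  spec Q t1 q1 p -> (t1 <= t)%N -> (q1 <= q)%N ->
  (forall a, Q a -> spec Q' (t - t1) (q - q1) (g a)) ->
  spec Q' t q (bind p g).
Proof.
move=> sp tt qq sg; rewrite -(subnKC tt) -(subnKC qq).
exact: spec_bind sp sg.
Qed.

Lemma spec_scal (A : Type) (a : A) : spec (eq a) 1 0 (scal R d a).
Proof. by []. Qed.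

Lemma spec_vect (A : Type) (a : A) : spec (eq a) d 0 (vect R d a).
Proof. by split=> //=; rewrite addn0. Qed.

Lemma spec_sqdistM x y : spec (eq (sqnorm (x - y))) (3 * d) 0 (sqdistM x y).
Proof.
split=> //=.
by apply: eq_bigr => j _; rewrite mxE.
Qed.

Lemma spec_phiM C x : (size C <= k)%N ->
  spec (eq (weight C x)) (6 * (k * d)) 0 (phiM C x).
Proof.
have kd : (0 < k * d)%N by rewrite muln_gt0 k_gt0.
case: C => [|c C] sC; first by split=> //=; lia.
have dkd : (d <= k * d)%N by rewrite leq_pmull.
apply: (spec_seq (spec_sqdistM x c)) => //; first lia.
move=> _ <-; rewrite weight_cons.
apply: spec_weaken.
- apply: (spec_foldM_foldl (h := fun m c' => Order.min m (sqnorm (x - c')))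
    (t := (3 * d + 1)%N) (q := 0%N)) => b c'.
  apply: (spec_seq (spec_sqdistM x c')) => //; first lia.
  by move=> _ <-; apply: spec_weaken (spec_scal _) _ _ _ => //; lia.
- by [].
(* As 0 < d, a loop round costs 3 d + 2 <= 5 d; the first center is charged like one more round. *)
- have : ((size C).+1 * (3 * d + 2) <= k * (5 * d))%N by apply: leq_mul => //; lia.
  by rewrite mulnCA mulSn -addnS; move: (size C * _)%N => v; lia.
- by rewrite muln0.
Qed.

Definition weight_sum (X C : seq point) : R := \sum_(x <- X) weight C x.

(** Reversed because the fold in [d2sample] builds its list by consing. *)
Let weights (X C : seq point) := rev [seq (x, weight C x) | x <- X].

Lemma sum_weights X C : \sum_(yr <- weights X C) yr.2 = weight_sum X C.
Proof. by rewrite (perm_big [seq (x, weight C x) | x <- X]) ?big_map //= perm_rev. Qed.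

Let spec_weights n X C : size X = n -> (size C <= k)%N ->
  spec (eq (weights X C)) (n * (6 * (k * d)).+1) 0
    (foldM (fun w x => let* e := phiM C x in Ret ((x, e) :: w)) [::] X).
Proof.
move=> <- sC; have := foldl_revmap (fun x => (x, weight C x)) X [::].
rewrite cats0 => E; rewrite /weights -E -[X in spec _ _ X](muln0 (size X)).
apply: spec_foldM_foldl => b x.
apply: (spec_seq (spec_phiM x sC)) => //.
by move=> _ <-; apply: spec_ret.
Qed.

Let spec_sum n (w : seq (point * R)) : size w = n ->
  spec (eq (\sum_(yr <- w) yr.2)) (n * 2) 0
    (foldM (fun t xe => scal R d (t + xe.2)) 0 w).
Proof.
move=> <-; rewrite -[X in spec (eq X)]add0r -foldl_sum -[X in spec _ _ X](muln0 (size w)).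
by apply: spec_foldM_foldl => b x; apply: spec_scal.
Qed.

Lemma spec_d2sample n X C : size X = n -> (0 < n)%N -> (size C <= k)%N ->
  spec (fun x => x \in X) (12 * (n * (k * d))) 0 (d2sample X C).
Proof.
move=> sX n0 sC; have kd : (0 < k * d)%N by rewrite muln_gt0 k_gt0.
have nkd : (n <= n * (k * d))%N by rewrite leq_pmulr.
have szw : size (weights X C) = n by rewrite -sX size_rev size_map.
have memw xr : xr \in weights X C -> xr.1 \in X /\ 0 <= xr.2.
  by rewrite mem_rev => /mapP[x xX ->]; rewrite weight_ge0.
apply: (spec_seq (spec_weights sX sC))=> //; first lia.
move=> _ <-.
apply: (spec_seq (spec_sum szw))=> //; first lia.
move=> _ <-.
apply: (spec_seq (spec_scal (\sum_(yr <- weights X C) yr.2 == 0)))=> //.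
  by lia.
(* The uniform fallback is what keeps the draw a probability distribution when all weights
   vanish. *)
move=> _ <-; rewrite szw; case: eqP => [_|/eqP W0].
- rewrite /draw; split => //=; first split.
  + rewrite big_map big_const_seq count_predT iter_addr addr0 szw.
    by rewrite ltr0n.
  + by move=> xr /mapP[yr /memw[? ?] ->].
  + rewrite size_map szw big1_seq ?addn0; first lia.
    by move=> xr _.
  + by rewrite big1_seq.
- rewrite /draw; split => //=; first split.
  + rewrite lt_def W0 /= big_seq; apply: sumr_ge0 => xr /memw[_ ?] //.
  + by move=> xr /memw[].
  + by rewrite szw big1_seq ?addn0 //; lia.
  + by rewrite big1_seq.
Qed.

Lemma expect_d2sample X C (f : point -> R) : (size C <= k)%N -> weight_sum X C != 0 ->
  expect same f (d2sample X C) =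
  \sum_(x <- X) weight C x / weight_sum X C * f x.
Proof.
move=> sC W0; rewrite /d2sample.
rewrite expect_bind (expect_det _ (spec_valid (spec_weights erefl sC))).
rewrite expect_bind (expect_det _ (spec_valid (spec_sum erefl))) sum_weights.
rewrite /= (negbTE W0) /= sum_weights.
by rewrite (perm_big [seq (x, weight C x) | x <- X]) ?perm_rev // big_map.
Qed.

Lemma spec_d2samples n X C m : size X = n -> (0 < n)%N -> (size C <= k)%N ->
  spec (fun S => size S = m /\ {subset S <= X})
    (m * (12 * (n * (k * d))).+1) 0 (d2samples X C m).
Proof.
move=> sX n0 sC; rewrite -[X in spec _ _ X](muln0 m).
apply: (spec_iterM (I := fun i S => size S = i /\ {subset S <= X})) => //.
move=> i S _ [<- SX].
apply: (spec_seq (spec_d2sample sX n0 sC))=> // x xX; apply: spec_ret.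
by split=> // y; rewrite inE => /orP[/eqP->//|/SX].
Qed.

Definition group (acc : seq point) (l : 'I_k) := [seq x <- acc | cl x == l].

Arguments group : simpl never.

Lemma group_cons s acc l :
  group (s :: acc) l = if cl s == l then s :: group acc l else group acc l.
Proof. by []. Qed.

(** The table of groups is encoded by the labels [ls] of its nonempty groups followed by [m] empty
    slots. A new label must be absent from [acc] and not merely from [ls]: the induction shortens
    [ls] while [acc] stays, and the new group must come out as the singleton of [s]. *)
Lemma spec_insertM s acc (ls : seq 'I_k) m :
  uniq ls -> {subset ls <= map cl acc} ->
  cl s \in ls \/ (0 < m)%N /\ cl s \notin map cl acc ->
  spec (eq (if cl s \in ls then [seq group (s :: acc) l | l <- ls] ++ nseq m [::]
            else [seq group (s :: acc) l | l <- rcons ls (cl s)] ++ nseq m.-1 [::]))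
    (2 * (size ls + m)) (size ls + m)
    (insertM s ([seq group acc l | l <- ls] ++ nseq m [::])).
Proof.
elim: ls => [|l ls IH] /= uls sub.
  case=> // -[m0 sacc]; case: m m0 => // m _ /=.
  split=> //=; rewrite group_cons eqxx.
  by rewrite /group -(@eq_in_filter _ pred0) ?filter_pred0 // => x xacc /=;
     apply/esym/negbTE; apply: contra sacc => /eqP <-; apply: map_f.
case/andP: uls => lls uls.
(* Each label in [ls] occurs in [acc], so its group is nonempty and its first point can be queried
   on behalf of the whole group. *)
have /mapP[y0 y0acc ly0] := sub l (mem_head _ _).
have : y0 \in group acc l by rewrite mem_filter y0acc ly0 eqxx.
case Eg: (group acc l) => [//|y g] _.
have cly : cl y = l.
  have : y \in group acc l by rewrite Eg mem_head.
  by rewrite mem_filter => /andP[/eqP].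
have subls : {subset ls <= map cl acc} by move=> x xl; apply: sub; rewrite inE xl orbT.
have sy : same s y = (cl s == l) by rewrite /same_cluster cly.
rewrite inE; have [sl|sl] := eqVneq (cl s) l => sls.
  rewrite sl eqxx in sy; split; rewrite /= sy /=; [|lia|lia].
  rewrite group_cons sl eqxx Eg; congr (_ :: _ ++ _).
  apply/eq_in_map => l' l'ls; rewrite group_cons sl; case: eqP => // E.
  by move: lls; rewrite E l'ls.
rewrite (negbTE sl) in sy.
have {sls} : cl s \in ls \/ (0 < m)%N /\ cl s \notin map cl acc.
  by case: sls => [/= ?|]; [left|right].
move=> /(IH uls subls) [v r q].
split; rewrite /= sy.
- apply: valid_bind v _ => _ <- /=.
  by rewrite (group_cons s acc l) (negbTE sl) Eg; case: ifP.
- apply: leq_ltn_trans (@runtime_bind _ _ _ _ _ _ _ _ 1 v _) _ => //.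
  by lia.
- apply: leq_ltn_trans (@queries_bind _ _ _ _ _ _ _ _ 0 v _) _ => //.
  by lia.
Qed.

Lemma group_uniq Rs y : uniq (map cl Rs) -> y \in Rs -> group Rs (cl y) = [:: y].
Proof.
elim: Rs => //= z Rs IH /andP[zRs uRs]; rewrite inE /group /=.
case/orP => [/eqP->|yRs].
  rewrite eqxx -(@eq_in_filter _ pred0) ?filter_pred0 // => x xRs /=.
  by apply/esym/negbTE; apply: contra zRs => /eqP <-; apply: map_f.
rewrite ifN ?IH //; first exact: IH.
by apply: contra zRs => /eqP ->; apply: map_f.
Qed.

(** [labs] lists the labels in the order in which their groups were opened. The representatives come
    first, so dropping [size Rs] groups leaves those of the uncovered clusters. *)
Definition grouped (Rs acc : seq point) (G : seq (seq point)) : Prop :=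
  exists2 labs : seq 'I_k,
    [/\ uniq labs, labs =i map cl (acc ++ Rs) & take (size Rs) labs = map cl Rs] &
    G = [seq group (acc ++ Rs) l | l <- labs] ++ nseq (k - size labs) [::].

Lemma size_labels (labs : seq 'I_k) : uniq labs -> (size labs <= k)%N.
Proof.
move=> u; rewrite -[X in (_ <= X)%N]card_ord -(card_uniqP u).
exact: max_card.
Qed.

Lemma spec_grouping N Rs S : size S = N -> uniq (map cl Rs) ->
  spec (grouped Rs (rev S)) (N * (2 * k).+1) (N * k)
    (foldM (fun G s => insertM s G)
       ([seq [:: y] | y <- Rs] ++ nseq (k - size Rs) [::]) S).
Proof.
move=> <- uRs.
apply: spec_weaken.
- apply: (spec_foldM (t := (2 * k)%N) (q := k)
    (I := fun rem G => exists2 acc, S = rev acc ++ rem & grouped Rs acc G)).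
  + move=> s rem G [acc ES [labs [ul eql tl] ->]].
    have sub : {subset labs <= map cl (acc ++ Rs)} by move=> l; rewrite eql.
    have [labk [E|lt]] : (size labs <= k)%N /\
        (cl s \in labs \/ (0 < k - size labs)%N /\ cl s \notin map cl (acc ++ Rs)).
      split; first exact: size_labels.
      (* A label not yet present guarantees a free slot: adding it to [labs] keeps a duplicate-free
         list over ['I_k]. *)
      have [|sl] := boolP (cl s \in labs); [by left|right].
      rewrite -eql sl; split => //.
      by have := @size_labels (cl s :: labs); rewrite /= sl ul subn_gt0 => ->.
    * have := spec_insertM (m := k - size labs) ul sub (or_introl E).
      rewrite E => H.
      apply: spec_weaken H _ _ _; try lia.
      move=> _ <-; exists (s :: acc); first by rewrite rev_cons cat_rcons.
      exists labs => //; split=> // l; rewrite inE -eql.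
      by case: eqP => // ->.
    * have [_ sacc] := lt.
      have H := spec_insertM ul sub (or_intror lt).
      apply: spec_weaken H _ _ _; try lia.
      rewrite -eql in sacc; rewrite (negbTE sacc).
      move=> _ <-; exists (s :: acc); first by rewrite rev_cons cat_rcons.
      have szR : (size Rs <= size labs)%N.
        by rewrite -(size_map cl Rs) -tl size_take_min geq_minr.
      exists (rcons labs (cl s)); last by rewrite size_rcons subnS.
      split; first by rewrite rcons_uniq sacc.
        by move=> l; rewrite mem_rcons !inE eql.
      by rewrite -cats1 takel_cat.
  + exists [::] => //; exists (map cl Rs); last first.
      rewrite size_map -map_comp; congr (_ ++ _); apply/eq_in_map => y yRs /=.
      by rewrite group_uniq.
    by split=> //; rewrite take_oversize // size_map.
- by move=> G [acc ->]; rewrite cats0 revK.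
- by [].
- by [].
Qed.

Lemma spec_largestM (G : seq (seq point)) B : (forall g, g \in G -> size g <= B)%N ->
  spec (fun g => (g = [::] \/ g \in G) /\ forall g', g' \in G -> (size g' <= size g)%N)
    (size G * (2 * B + 2)) 0 (largestM G).
Proof.
move=> GB; apply: spec_weaken.
- apply: (spec_foldM (t := (2 * B + 1)%N) (q := 0) (I := fun rem best =>
    [/\ (best = [::] \/ best \in G), {subset rem <= G} &
        forall g, g \in G -> g \in rem \/ (size g <= size best)%N])).
  + move=> g rem best [bG rG max].
    have gG : g \in G by apply: rG; rewrite mem_head.
    have sb : (size best <= B)%N by case: bG => [->//|/GB].
    have sg := GB _ gG.
    split=> //=; last first.
      by move: sb sg; move: (size best) (size g) => u v; lia.
    split.
    * by case: ifP => _; [right|].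
    * by move=> x xr; apply: rG; rewrite inE xr orbT.
    * move=> g' /max; rewrite inE => -[/orP[/eqP->|]|]; [right|by left|right].
        by case: ltnP.
      by case: ltnP => // /ltnW; apply: leq_trans.
  + by split=> //; [left|move=> g gG; left].
- by move=> g [bG _ max]; split=> // g' /max[].
- by rewrite -addnS.
- by rewrite muln0.
Qed.

Lemma spec_closestM C g : (size C <= k)%N ->
  spec (fun os => if os is Some s then
      s \in g /\ forall x, x \in g -> weight C s <= weight C x else g = [::])
    (size g * (6 * (k * d) + 2)) 0 (closestM C g).
Proof.
move=> sC; case: g => [//|s0 g]; rewrite [size _]/=.
rewrite mulSn; apply: (spec_seq (spec_phiM s0 sC))=> //; first lia.
move=> _ <-.
have H : spec (fun se : point * R => [/\ se.1 \in s0 :: g, se.2 = weight C se.1 &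
     forall x, x \in s0 :: g -> se.2 <= weight C x])
   (size g * (6 * (k * d) + 2)) 0
   (foldM (fun se s => let* e := phiM C s in
       scal R d (if e < se.2 then (s, e) else se)) (s0, weight C s0) g).
  apply: spec_weaken.
  - apply: (spec_foldM (t := (6 * (k * d) + 1)%N) (q := 0) (I := fun rem se =>
      [/\ se.1 \in s0 :: g, se.2 = weight C se.1, {subset rem <= g} &
        forall x, x \in s0 :: g -> x \in rem \/ se.2 <= weight C x])).
    + move=> s rem [s1 e1] /= [s1g -> rg min].
      apply: (spec_seq (spec_phiM s sC))=> //; first lia.
      move=> _ <-; apply: spec_weaken (spec_scal _) _ _ _ => //; last lia.
      move=> _ <-; split.
      * by case: ifP => //= _; rewrite inE rg ?orbT // mem_head.
      * by case: ifP.
      * by move=> x xr; apply: rg; rewrite inE xr orbT.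
      * move=> x /min; rewrite inE => -[/orP[/eqP->|]|]; [right|by left|right].
          by case: ltP => //= /ltW.
        by case: ltP => //= /ltW h; apply: le_trans h _.
    + split=> //=; first by rewrite mem_head.
      by move=> x; rewrite inE => /orP[/eqP->|]; [right|left].
  - by move=> [s1 e1] /= [? ? _ min]; split=> // x /min[].
  - by rewrite -addnS.
  - by rewrite muln0.
apply: spec_seq H _ _ _ => //; first by rewrite -addnA addKn leq_addl.
move=> [s1 e1] /= [s1g E min]; apply: spec_ret; split=> // x /min.
by rewrite E.
Qed.

(** Everything that the probabilistic analysis uses about the choice of the seed. *)
Definition uncovered_spec (C S Rs : seq point) (os : option point) : Prop :=
  if os is Some s then
    [/\ s \in S, cl s \notin map cl Rs,
        forall l, l \notin map cl Rs ->
          (count (fun x => cl x == l) S <= count (fun x => cl x == cl s) S)%N &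
        forall x, x \in S -> cl x = cl s -> weight C s <= weight C x]
  else forall x, x \in S -> cl x \in map cl Rs.

Lemma spec_uncovered_cluster N C S Rs :
  size S = N -> (size C <= k)%N -> uniq (map cl Rs) ->
  let B := (N + k)%N in
  spec (uncovered_spec C S Rs)
    (k + N * (2 * k).+1 + k * (2 * B + 2) + B * (6 * (k * d) + 2))
    (N * k) (uncovered_cluster k C S Rs).
Proof.
move=> sS sC uRs B; rewrite /uncovered_cluster -!addnA.
apply: (spec_seq (Q := eq ([seq [:: y] | y <- Rs] ++ nseq (k - size Rs) [::]))
  (t1 := k) (q1 := 0)) => //; [by split=> //=; lia|lia|move=> _ <-].
apply: (spec_seq (spec_grouping sS uRs)); [lia|lia|].
move=> _ [labs [ul eql tl] ->].
set acc := rev S ++ Rs in eql *.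
have labk := size_labels ul.
have Rsk : (size Rs <= k)%N by rewrite -(size_map cl); apply: size_labels.
have szR : (size Rs <= size labs)%N.
  by rewrite -(size_map cl Rs) -tl size_take_min geq_minr.
have accB : (size acc <= B)%N by rewrite size_cat size_rev sS leq_add2l.
have grpB l : (size (group acc l) <= B)%N.
  by rewrite size_filter (leq_trans (count_size _ _)).
have -> : drop (size Rs) ([seq group acc l | l <- labs] ++ nseq (k - size labs) [::])
    = [seq group acc l | l <- drop (size Rs) labs] ++ nseq (k - size labs) [::].
  rewrite drop_cat size_map; case: ltnP => h; first by rewrite map_drop.
  by rewrite (eqP szR) drop0 (drop_oversize h).
set G := _ ++ _.
have GB g : g \in G -> (size g <= B)%N.
  rewrite mem_cat => /orP[/mapP[l _ ->//]|]; by rewrite mem_nseq => /andP[_ /eqP->].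
have szG : (size G <= k)%N.
  rewrite size_cat size_map size_drop size_nseq; lia.
have tdl : uniq (map cl Rs ++ drop (size Rs) labs) by rewrite -tl cat_take_drop.
(* The group of an uncovered label contains no representative, hence consists of samples only. *)
have grpS l : l \notin map cl Rs -> group acc l = rev [seq x <- S | cl x == l].
  move=> lRs; rewrite /group filter_cat -filter_rev -[RHS]cats0; congr (_ ++ _).
  apply/eqP; rewrite -(negbK (_ == _)) -has_filter; apply/hasPn => y yRs.
  by apply: contra lRs => /eqP <-; apply: map_f.
have covdrop x : x \in S -> cl x \notin map cl Rs -> cl x \in drop (size Rs) labs.
  move=> xS xR; have : cl x \in take (size Rs) labs ++ drop (size Rs) labs.
    by rewrite cat_take_drop eql map_f // mem_cat mem_rev xS.
  by rewrite tl mem_cat (negbTE xR).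
have szGB : (size G * (2 * B + 2) <= k * (2 * B + 2))%N by rewrite leq_mul2r szG orbT.
apply: (spec_seq (spec_largestM GB))=> //; first lia.
move=> g [gG gmax].
have gB : (size g <= B)%N by case: gG => [->//|/GB].
have gBB : (size g * (6 * (k * d) + 2) <= B * (6 * (k * d) + 2))%N.
  by rewrite leq_mul2r gB orbT.
apply: spec_weaken (spec_closestM g sC) _ _ _ => //; last lia.
move=> [s [sg smin]|gE] /=.
- have gne : g != [::] by case: (g) sg.
  have {gG} : g \in G by case: gG => // E; rewrite E in gne.
  rewrite mem_cat => /orP[/mapP[l ldrop gE]|]; last first.
    by rewrite mem_nseq => /andP[_ E]; rewrite E in gne.
  have lR : l \notin map cl Rs.
    by move: tdl; rewrite cat_uniq => /and3P[_ /hasPn/(_ _ ldrop)].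
  move: (sg); rewrite gE grpS // mem_rev mem_filter => /andP[/eqP sl s_S].
  rewrite sl; split=> //.
  + move=> l' l'R; have [] := boolP (has (fun x => cl x == l') S); last first.
      by rewrite has_count -leqNgt leqn0 => /eqP->.
    case/hasP => x xS /eqP xl'; move: l'R; rewrite -xl' => xR.
    have := gmax (group acc (cl x)); rewrite gE !grpS // !size_rev !size_filter.
    by apply; rewrite -grpS // mem_cat map_f // covdrop.
  + move=> x xS xl; apply: smin; rewrite gE grpS // mem_rev mem_filter xS xl.
    by rewrite eqxx.
- move=> x xS; apply/negPn/negP => xR.
  have := gmax (group acc (cl x)); rewrite gE grpS // size_rev size_filter leqn0.
  rewrite -grpS // mem_cat map_f ?covdrop // => /(_ isT).
  by apply/negP; rewrite -lt0n -has_count; apply/hasP; exists x.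
Qed.

End Subroutines.

Lemma natr_ceil (R : realType) (x : R) : 0 <= x ->
  x <= (`|Num.ceil x|%N)%:R <= x + 1.
Proof.
move=> x0; have c0 : 0 <= Num.ceil x by rewrite -(ceil0 R) ceil_le.
have -> : (`|Num.ceil x|%N)%:R = (Num.ceil x)%:~R :> R.
  by rewrite -[in RHS](gez0_abs c0) pmulrn.
rewrite ceil_ge /=; have := ltW (ceilB1_lt x); rewrite intrB /=; lra.
Qed.

(** * One iteration of the algorithm, and the time and query bounds *)

Section Iteration.
Variables (R : realType) (d n k : nat) (cl : 'rV[R]_d -> 'I_k).
Variables (eps : R) (X : seq 'rV[R]_d).
Hypotheses (d_gt0 : (0 < d)%N) (n_gt0 : (0 < n)%N) (k_gt0 : (0 < k)%N).
Hypotheses (sX : size X = n) (eps_gt0 : 0 < eps).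
Local Notation point := 'rV[R]_d.
Local Notation prg := (prog R point).
Local Notation same := (same_cluster cl).
Local Notation spec := (spec same).

Definition keep_prob (C : seq point) (s x : point) : R :=
  Order.min 1 (eps / 128 * (weight C s / weight C x)).

(** The loop body of [uniform_sample], named so that its expectation can be computed once. *)
Definition thinning_step (C : seq point) (s : point) (T : seq point) :
    prg (seq point) :=
  let* x := d2sample X C in
  let* b := ask s x in
  if b then
    let* es := phiM C s in
    let* ex := phiM C x in
    let* r := Tick 4 (Ret (Order.min 1 (eps / 128 * (es / ex)))) in
    let* keep := coin d r in
    Ret (if keep then x :: T else T)
  else Ret T.

Lemma keep_prob_bounds C s x : 0 <= keep_prob C s x <= 1.
Proof.
rewrite /keep_prob ge_min lexx le_min ler01 /= andbT.
by rewrite mulr_ge0 ?divr_ge0 ?weight_ge0 // ltW.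
Qed.

Lemma spec_thinning_step C s T : (size C <= k)%N ->
  spec (fun T' => T' = T \/ exists x, [/\ x \in X, cl x = cl s & T' = x :: T])
    (12 * (n * (k * d)) + 12 * (k * d) + 6) 1 (thinning_step C s T).
Proof.
move=> sC; apply: (spec_seq (spec_d2sample cl d_gt0 k_gt0 sX n_gt0 sC)); [lia|by []|].
move=> x xX; apply: (spec_seq (Q := eq (same s x)) (t1 := 1) (q1 := 1)) => //.
  by lia.
move=> _ <-; rewrite /same_cluster; case: eqP => [sx|_]; last by apply: spec_ret; left.
apply: (spec_seq (spec_phiM cl d_gt0 k_gt0 s sC)) => //; [lia|move=> _ <-].
apply: (spec_seq (spec_phiM cl d_gt0 k_gt0 x sC)) => //; [lia|move=> _ <-].
split=> //=; last lia.
split; [exact: keep_prob_bounds| |by left].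
by right; exists x.
Qed.

Lemma expect_thinning_step C s T (f : seq point -> R) :
  (size C <= k)%N -> weight_sum X C != 0 ->
  expect same f (thinning_step C s T) =
  \sum_(x <- X) weight C x / weight_sum X C *
    (if cl x == cl s then keep_prob C s x * f (x :: T) +
      (1 - keep_prob C s x) * f T else f T).
Proof.
move=> sC W0; rewrite expect_bind expect_d2sample //.
apply: eq_bigr => x _; congr (_ * _).
rewrite /= /same_cluster eq_sym; case: ifP => //= _.
rewrite expect_bind (expect_det _ (spec_valid (spec_phiM cl d_gt0 k_gt0 s sC))).
by rewrite expect_bind (expect_det _ (spec_valid (spec_phiM cl d_gt0 k_gt0 x sC))).
Qed.

Lemma spec_uniform_sample C s : (size C <= k)%N ->
  let L := constL k eps in
  spec (fun T => (size T <= L)%N /\ forall x, x \in T -> x \in X /\ cl x = cl s)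
    (L * (12 * (n * (k * d)) + 12 * (k * d) + 7)) L (uniform_sample k eps X C s).
Proof.
move=> sC L; rewrite [X in spec _ (L * X)%N]addnS -[X in spec _ _ X](muln1 L).
apply: (spec_iterM (I := fun i T => (size T <= i)%N /\
  forall x, x \in T -> x \in X /\ cl x = cl s)) => // i T _ [sT TX].
apply: spec_weaken (spec_thinning_step s T sC) _ _ _ => //.
move=> T' [->|[x [xX xs ->]]]; first by split=> //; apply: leqW.
split=> // y; rewrite inE => /orP[/eqP->//|]; exact: TX.
Qed.

(** The value on the empty list is 0, which makes the centroid of an empty cluster defined. *)
Definition mean (T : seq point) : point := (size T)%:R^-1 *: \sum_(x <- T) x.

Lemma spec_centroidM T L : (size T <= L)%N ->
  spec (eq (mean T)) (L * d.+1 + L + d) 0 (centroidM T).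
Proof.
move=> sT; have sTd : (size T * d.+1 <= L * d.+1)%N by rewrite leq_mul2r sT orbT.
have H : spec (eq (\sum_(x <- T) x)) (L * d.+1) 0
    (foldM (fun v x => vect R d (v + x)) 0 T).
  apply: spec_weaken.
  - by apply: (spec_foldM_foldl (h := +%R) (t := d) (q := 0%N)) => b x; apply: spec_vect.
  - suff E v : foldl +%R v T = v + \sum_(x <- T) x by rewrite E add0r.
    elim: T {sT sTd} v => [|x T IH] v /=; first by rewrite big_nil addr0.
    by rewrite big_cons IH addrA.
  - by [].
  - by rewrite muln0.
apply: (spec_seq H) => //; first by rewrite -addnA leq_addr.
move=> _ <-; split=> //=.
by rewrite addn0 -addnA addKn leq_add2r.
Qed.

Definition kmeans_step (RC : seq point * seq point) : prg (seq point * seq point) :=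
  let* S := d2samples X RC.2 (constN k eps) in
  let* os := uncovered_cluster k RC.2 S RC.1 in
  if os is Some s then
    let* T := uniform_sample k eps X RC.2 s in
    let* few := Tick (size T) (scal R d ((size T)%:R < constM k eps)) in
    if few then Ret RC
    else let* c := centroidM T in Ret (rcons RC.1 s, rcons RC.2 c)
  else Ret RC.

Definition wf_state (i : nat) (RC : seq point * seq point) : Prop :=
  [/\ (size RC.1 <= i)%N, (size RC.2 <= i)%N & uniq (map cl RC.1)].

(** In order: drawing S, choosing the seed, drawing T, the test on its size, its centroid. *)
Definition step_time : nat :=
  let N := constN k eps in let L := constL k eps in let B := (N + k)%N in
  N * (12 * (n * (k * d))).+1 +
  (k + N * (2 * k).+1 + k * (2 * B + 2) + B * (6 * (k * d) + 2)) +
  L * (12 * (n * (k * d)) + 12 * (k * d) + 7) + L.+1 + (L * d.+1 + L + d).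

Lemma spec_kmeans_step i RC : (i <= k)%N -> wf_state i RC ->
  spec (fun RC' => wf_state i.+1 RC' /\
      (RC'.2 = RC.2 \/ exists c, RC'.2 = rcons RC.2 c))
    step_time (constN k eps * k + constL k eps) (kmeans_step RC).
Proof.
move=> ik [sR sC uR]; have sCk := leq_trans sC ik.
have wfS : wf_state i.+1 RC by split=> //; apply: leqW.
rewrite /step_time; set N := constN k eps; set L := constL k eps.
set B := (N + k)%N.
apply: (spec_seq (spec_d2samples cl d_gt0 k_gt0 N sX n_gt0 sCk)) => //.
  by rewrite -!addnA leq_addr.
rewrite -!addnA addKn !addnA => S [sS SX].
apply: (spec_seq (spec_uncovered_cluster d_gt0 k_gt0 sS sCk uR)).
- by rewrite -!addnA !leq_add2l leq_addr.
- by rewrite subn0 leq_addr.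
move=> [s|] us; last by apply: spec_ret; split=> //; left.
have [_ sR' _ _] := us.
set Q := (X in spec X).
apply: (@spec_weaken _ _ _ _ Q Q
  (L * (12 * (n * (k * d)) + 12 * (k * d) + 7) + (L.+1 + (L * d.+1 + L + d)))
  (L + (0 + 0))) => //; last by lia.
- apply: spec_bind (spec_uniform_sample s sCk) _ => T [sT _].
  apply: (spec_bind (Q := fun=> True)) => [|few _].
    by split=> //=; rewrite addn1 ltnS.
  case: few; first by apply: spec_ret; split=> //; left.
  rewrite -[X in spec _ X]addn0 -[X in spec _ _ X]addn0.
  apply: spec_bind (spec_centroidM sT) _ => c _; apply: spec_ret.
  split; last by right; exists c.
  by split; rewrite /= ?size_rcons ?map_rcons ?rcons_uniq ?sR' // ltnS.
- by rewrite /B; lia.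
Qed.

Lemma spec_iter_kmeans_step :
  spec (wf_state k) (k * step_time.+1) (k * (constN k eps * k + constL k eps))
    (Defs.iterM k kmeans_step ([::], [::])).
Proof.
apply: (spec_iterM (I := wf_state)) => // i RC ik wf.
by apply: spec_weaken (spec_kmeans_step (ltnW ik) wf) _ _ _ => // RC' [].
Qed.

Lemma spec_query_kmeans :
  spec (fun=> True) (k * step_time.+1) (k * (constN k eps * k + constL k eps))
    (query_kmeans X k eps).
Proof.
rewrite -[X in spec _ X]addn0 -[X in spec _ _ X]addn0.
by apply: spec_bind spec_iter_kmeans_step _ => RC _; apply: spec_ret.
Qed.

Hypothesis eps_le : eps <= 1 / 2.

Lemma constN_bounds :
  2 ^+ 12 * k%:R ^+ 3 / eps ^+ 2 <= (constN k eps)%:R <= 2 ^+ 13 * (k%:R ^+ 3 / eps ^+ 2).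
Proof.
have k1 : 1 <= k%:R :> R by rewrite ler1n.
have k3 : 1 <= k%:R ^+ 3 :> R by rewrite exprn_ege1.
have e2 : 0 < eps ^+ 2 by rewrite exprn_gt0.
have e21 : eps ^+ 2 <= 1 by apply: exprn_ile1; [exact: ltW|have := eps_le; lra].
(* As this quotient is at least 1, the loss of at most 1 in rounding up is absorbed by doubling the
   constant. *)
have x1 : 1 <= k%:R ^+ 3 / eps ^+ 2 by rewrite ler_pdivlMr // mul1r (le_trans e21).
have /natr_ceil/andP[h1 h2] : 0 <= 2 ^+ 12 * k%:R ^+ 3 / eps ^+ 2.
  by rewrite -mulrA; apply: mulr_ge0; [rewrite exprn_ge0|lra].
by rewrite h1 /=; apply: le_trans h2 _; rewrite -mulrA; lra.
Qed.

Lemma constL_bounds :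
  2 ^+ 23 * k%:R ^+ 2 / eps ^+ 4 <= (constL k eps)%:R <= 2 ^+ 24 * (k%:R ^+ 2 / eps ^+ 4).
Proof.
have k1 : 1 <= k%:R :> R by rewrite ler1n.
have k3 : 1 <= k%:R ^+ 2 :> R by rewrite exprn_ege1.
have e2 : 0 < eps ^+ 4 by rewrite exprn_gt0.
have e21 : eps ^+ 4 <= 1 by apply: exprn_ile1; [exact: ltW|have := eps_le; lra].
have x1 : 1 <= k%:R ^+ 2 / eps ^+ 4 by rewrite ler_pdivlMr // mul1r (le_trans e21).
have /natr_ceil/andP[h1 h2] : 0 <= 2 ^+ 23 * k%:R ^+ 2 / eps ^+ 4.
  by rewrite -mulrA; apply: mulr_ge0; [rewrite exprn_ge0|lra].
by rewrite h1 /=; apply: le_trans h2 _; rewrite -mulrA; lra.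
Qed.

(** Needed to charge terms such as k * k, which contain neither N nor L, to the samples. *)
Lemma constN_ge : (k <= constN k eps)%N.
Proof.
have /andP[h _] := constN_bounds; rewrite -(ler_nat R); apply: le_trans h.
have k1 : 1 <= k%:R :> R by rewrite ler1n.
have e2 : 0 < eps ^+ 2 by rewrite exprn_gt0.
have e21 : eps ^+ 2 <= 1 by apply: exprn_ile1; [exact: ltW|have := eps_le; lra].
have k2 : k%:R <= k%:R ^+ 3 :> R by rewrite -[leLHS]expr1 ler_weXn2l.
rewrite ler_pdivlMr //; apply: (@le_trans _ _ k%:R); last by lra.
by rewrite ler_piMr // ler0n.
Qed.

Lemma runtime_query_kmeans :
  (runtime same (query_kmeans X k eps))%:R
    <= 2 ^+ 34 * (n%:R * d%:R * k%:R ^+ 5 / eps ^+ 4).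
Proof.
have [_ rt _] := spec_query_kmeans.
have kN := constN_ge.
(* Every monomial of [step_time] is at most N Z or L Z with Z = n k d; given these comparisons the
   bound is linear in the products. *)
have step : (step_time.+1 <= 64 * ((n * (k * d)) * (constN k eps + constL k eps)))%N.
  rewrite /step_time; set N := constN k eps in kN *; set L := constL k eps.
  set Z := (n * (k * d))%N.
  have kdZ : (k * d <= Z)%N by rewrite leq_pmull.
  have kZ : (k <= Z)%N by rewrite (leq_trans _ kdZ) // leq_pmulr.
  have dZ : (d <= Z)%N by rewrite (leq_trans _ kdZ) // leq_pmull.
  have N0 : (0 < N)%N by rewrite (leq_trans k_gt0).
  have f1 : (N * k <= N * Z)%N by rewrite leq_mul2l kZ orbT.
  have f2 : (N * (k * d) <= N * Z)%N by rewrite leq_mul2l kdZ orbT.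
  have f3 : (L * (k * d) <= L * Z)%N by rewrite leq_mul2l kdZ orbT.
  have f4 : (L * d <= L * Z)%N by rewrite leq_mul2l dZ orbT.
  have f5 : (k * k <= N * Z)%N by apply: leq_mul.
  have f6 : (k * (k * d) <= N * Z)%N by apply: leq_mul.
  have f7 : (L <= L * Z)%N by rewrite leq_pmulr // (leq_trans k_gt0).
  have f8 : (N <= N * Z)%N by rewrite leq_pmulr // (leq_trans k_gt0).
  have f9 : (d <= N * Z)%N by rewrite (leq_trans dZ) // leq_pmull.
  clearbody N L Z; lia.
have /andP[_ hN] := constN_bounds; have /andP[_ hL] := constL_bounds.
have e1 : eps ^+ 2 <= 1 by apply: exprn_ile1; [exact: ltW|have := eps_le; lra].
have NL : (k%:R * (n%:R * (k%:R * d%:R))) * ((constN k eps)%:R + (constL k eps)%:R)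
    <= 2 ^+ 25 * (n%:R * d%:R * k%:R ^+ 5 / eps ^+ 4) :> R.
  have k1 : 1 <= k%:R :> R by rewrite ler1n.
  have e4 : 0 < eps ^+ 4 by rewrite exprn_gt0.
  have hN' : (constN k eps)%:R <= 2 ^+ 13 * (k%:R ^+ 3 / eps ^+ 4).
    apply: le_trans hN _; rewrite ler_pM2l ?exprn_gt0 //.
    rewrite ler_pM2l ?exprn_gt0 ?ltr0n // lef_pV2 ?posrE ?exprn_gt0 //.
    by rewrite (exprD eps 2 2) ler_piMr // exprn_ge0 // ltW.
  have hL' : (constL k eps)%:R <= 2 ^+ 24 * (k%:R ^+ 3 / eps ^+ 4).
    apply: le_trans hL _; rewrite ler_pM2l ?exprn_gt0 //.
    by rewrite ler_pM2r ?invr_gt0 // ler_weXn2l.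
  apply: le_trans (ler_wpM2l _ (lerD hN' hL')) _; first by rewrite !mulr_ge0 ?ler0n.
  have -> : k%:R * (n%:R * (k%:R * d%:R)) * (2 ^+ 13 * (k%:R ^+ 3 / eps ^+ 4) +
      2 ^+ 24 * (k%:R ^+ 3 / eps ^+ 4)) =
      (2 ^+ 13 + 2 ^+ 24) * (n%:R * d%:R * k%:R ^+ 5 / eps ^+ 4) :> R.
    by ring.
  by rewrite ler_wpM2r //; [rewrite divr_ge0 ?mulr_ge0 ?ler0n ?exprn_ge0 // ltW|lra].
apply: (@le_trans _ _ (k * (64 * ((n * (k * d)) * (constN k eps + constL k eps))))%:R).
  by rewrite ler_nat (leq_trans rt) // leq_mul2l step orbT.
rewrite !(natrM, natrD); have := ler_wpM2l (ler0n R 64) NL.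
have -> : 2 ^+ 34 = 64 * 2 ^+ 25 * 8 :> R by ring.
have : 0 <= n%:R * d%:R * k%:R ^+ 5 / eps ^+ 4 :> R.
  by rewrite divr_ge0 ?mulr_ge0 ?ler0n ?exprn_ge0 // ltW.
by lra.
Qed.

Lemma queries_query_kmeans :
  (queries same (query_kmeans X k eps))%:R <= 2 ^+ 25 * (k%:R ^+ 5 / eps ^+ 4).
Proof.
have [_ _ qr] := spec_query_kmeans.
have /andP[_ hN] := constN_bounds; have /andP[_ hL] := constL_bounds.
have k1 : 1 <= k%:R :> R by rewrite ler1n.
have e4 : 0 < eps ^+ 4 by rewrite exprn_gt0.
have e1 : eps ^+ 2 <= 1 by apply: exprn_ile1; [exact: ltW|have := eps_le; lra].
have hN' : (constN k eps)%:R <= 2 ^+ 13 * (k%:R ^+ 3 / eps ^+ 4).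
  apply: le_trans hN _; rewrite ler_pM2l ?exprn_gt0 //.
  rewrite ler_pM2l ?exprn_gt0 ?ltr0n // lef_pV2 ?posrE ?exprn_gt0 //.
  by rewrite (exprD eps 2 2) ler_piMr // exprn_ge0 // ltW.
have hL' : (constL k eps)%:R <= 2 ^+ 24 * (k%:R ^+ 4 / eps ^+ 4).
  apply: le_trans hL _; rewrite ler_pM2l ?exprn_gt0 //.
  by rewrite ler_pM2r ?invr_gt0 // ler_weXn2l.
apply: (@le_trans _ _ (k * (constN k eps * k + constL k eps))%:R).
  by rewrite ler_nat.
rewrite !(natrM, natrD).
have k0 : 0 <= k%:R :> R by rewrite ler0n.
have := ler_wpM2l k0 (lerD (ler_wpM2r k0 hN') hL').
have : 0 <= k%:R ^+ 5 / eps ^+ 4 :> R.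
  by rewrite divr_ge0 ?exprn_ge0 // ltW.
have -> : k%:R * (2 ^+ 13 * (k%:R ^+ 3 / eps ^+ 4) * k%:R +
      2 ^+ 24 * (k%:R ^+ 4 / eps ^+ 4)) = (2 ^+ 13 + 2 ^+ 24) * (k%:R ^+ 5 / eps ^+ 4) :> R.
  by ring.
by lra.
Qed.

End Iteration.

(** * Geometry of an optimal clustering *)

Section SquaredNorm.
Variables (R : realType) (d : nat).
Implicit Types u v c : 'rV[R]_d.

Lemma sqnormN v : sqnorm (- v) = sqnorm v.
Proof. by apply: eq_bigr => j _; rewrite mxE sqrrN. Qed.

Lemma sqnormB u v : sqnorm (u - v) = sqnorm (v - u).
Proof. by rewrite -sqnormN opprB. Qed.

Lemma sqnormZ a v : sqnorm (a *: v) = a ^+ 2 * sqnorm v.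
Proof. by rewrite /sqnorm mulr_sumr; apply: eq_bigr => j _; rewrite mxE exprMn. Qed.

(** Young's inequality in each coordinate: the difference of the two sides is a^-1 (a x - y)^2. It
    replaces the triangle inequality for squared distances. *)
Lemma sqnormD_le a u v : 0 < a ->
  sqnorm (u + v) <= (1 + a) * sqnorm u + (1 + a^-1) * sqnorm v.
Proof.
move=> a0; rewrite /sqnorm !mulr_sumr -big_split /=; apply: ler_sum => j _.
rewrite mxE; move: (u 0 j) (v 0 j) => x y; rewrite -subr_ge0.
have -> : (1 + a) * x ^+ 2 + (1 + a^-1) * y ^+ 2 - (x + y) ^+ 2 =
    a^-1 * (a * x - y) ^+ 2 by field; rewrite gt_eqF.
by rewrite mulr_ge0 ?sqr_ge0 // invr_ge0 ltW.
Qed.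

Lemma sum_sub_mean (Y : seq 'rV[R]_d) : \sum_(y <- Y) (y - mean Y) = 0.
Proof.
rewrite big_split /= sumrN big_const_seq count_predT iter_addr addr0 /mean.
case: Y => [|y Y]; first by rewrite big_nil subr0.
by rewrite -scaler_nat scalerA divff ?scale1r ?subrr // pnatr_eq0.
Qed.

(** The parallel-axis identity: after expanding the squares, the cross term vanishes by
    [sum_sub_mean]. *)
Lemma sum_sqnorm_mean (Y : seq 'rV[R]_d) c :
  \sum_(y <- Y) sqnorm (y - c) =
  \sum_(y <- Y) sqnorm (y - mean Y) + (size Y)%:R * sqnorm (mean Y - c).
Proof.
rewrite /sqnorm exchange_big [X in _ = X + _]exchange_big /= mulr_sumr -big_split /=.
apply: eq_bigr => j _.
have s0 : \sum_(y <- Y) ((y - mean Y) 0 j) = 0.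
  by have := congr1 (fun v : 'rV_d => v 0 j) (sum_sub_mean Y); rewrite summxE mxE.
rewrite (eq_bigr (fun y => (y - mean Y) 0 j ^+ 2 +
   (2 * (mean Y - c) 0 j * (y - mean Y) 0 j + (mean Y - c) 0 j ^+ 2))); last first.
  by move=> y _; rewrite !mxE; ring.
rewrite !big_split /= -mulr_sumr s0 mulr0 add0r; congr (_ + _).
by rewrite big_const_seq count_predT iter_addr addr0 mulr_natl.
Qed.

Lemma Delta1_mean (Y : seq 'rV[R]_d) :
  Delta 1 Y = (\sum_(y <- Y) sqnorm (y - mean Y))%:E.
Proof.
have Phi_seq1 c : Phi [:: c] Y = (\sum_(y <- Y) sqnorm (y - c))%:E.
  rewrite Phi_weight //; congr (_%:E); apply: eq_bigr => y _.
  by rewrite weight_cons.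
apply/eqP; rewrite eq_le; apply/andP; split.
  by apply: ereal_inf_lbound; exists [:: mean Y] => //; rewrite Phi_seq1.
apply: le_ereal_inf_tmp => _ [[|c [|//]] //= _ <-].
rewrite Phi_seq1 lee_fin (sum_sqnorm_mean _ c) lerDl.
by rewrite mulr_ge0 ?sqnorm_ge0.
Qed.

End SquaredNorm.

(** * Consequences of optimality and irreducibility for good states *)

Section OptimalClustering.
Variables (R : realType) (d k : nat) (cl : 'rV[R]_d -> 'I_k).
Variables (eps : R) (X : seq 'rV[R]_d).
Hypotheses (k_gt0 : (0 < k)%N) (X_neq0 : X != [::]).
Hypotheses (eps_gt0 : 0 < eps) (eps_le : eps <= 1 / 2).
Hypothesis irr : irreducible k eps X.
Hypothesis opt : optimal_clustering X cl.
Local Notation point := 'rV[R]_d.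

Definition center (j : 'I_k) : point := mean (cluster_of X cl j).
Definition csize (j : 'I_k) : R := (size (cluster_of X cl j))%:R.
Definition ccost (j : 'I_k) : R := \sum_(x <- X | cl x == j) sqnorm (x - center j).
Definition optcost : R := \sum_j ccost j.

Lemma ccost_ge0 j : 0 <= ccost j.
Proof. by apply: sumr_ge0 => x _; apply: sqnorm_ge0. Qed.

Lemma optcost_ge0 : 0 <= optcost.
Proof. by apply: sumr_ge0 => j _; apply: ccost_ge0. Qed.

Lemma ccost_le_optcost j : ccost j <= optcost.
Proof.
rewrite /optcost (bigD1 j) //= lerDl; apply: sumr_ge0 => i _.
exact: ccost_ge0.
Qed.

Lemma csize_ge0 j : 0 <= csize j. Proof. exact: ler0n. Qed.

Lemma csize_ge1 x : x \in X -> 1 <= csize (cl x).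
Proof.
move=> xX; rewrite /csize ler1n size_filter -has_count.
by apply/hasP; exists x.
Qed.

Lemma csizeE j : \sum_(x <- X | cl x == j) 1 = csize j.
Proof.
rewrite /csize size_filter -big_filter big_const_seq count_predT iter_addr addr0.
by rewrite size_filter.
Qed.

Lemma cluster_sqnorm j c :
  \sum_(x <- X | cl x == j) sqnorm (x - c) = ccost j + csize j * sqnorm (center j - c).
Proof.
by rewrite /ccost -[in LHS]big_filter -[X in _ = X + _]big_filter sum_sqnorm_mean.
Qed.

Lemma sum_by_cluster (F : point -> R) :
  \sum_(x <- X) F x = \sum_j \sum_(x <- X | cl x == j) F x.
Proof. by rewrite (partition_big cl predT). Qed.

Lemma Delta_optcost : Delta k X = optcost%:E.
Proof.
rewrite -opt /optcost -sumEFin; apply: eq_bigr => j _.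
by rewrite Delta1_mean /ccost -[in RHS]big_filter.
Qed.

(** The assignment [g] need not pick nearest centers, so optimality can be tested against any
    convenient competitor. *)
Lemma Delta_le_assign (C : seq point) (g : point -> point) :
  C != [::] -> (forall x, x \in X -> g x \in C) ->
  (Delta (size C) X <= (\sum_(x <- X) sqnorm (x - g x))%:E)%E.
Proof.
move=> C0 gC; apply: (@le_trans _ _ (Phi C X)).
  by apply: ereal_inf_lbound; exists C.
rewrite Phi_weight // lee_fin !big_seq; apply: ler_sum => x xX.
by rewrite weight_le ?gC.
Qed.

Lemma optcostE : optcost = \sum_(x <- X) sqnorm (x - center (cl x)).
Proof.
rewrite sum_by_cluster; apply: eq_bigr => j _.
by apply: eq_bigr => x /eqP ->.
Qed.

(** Otherwise sending [x] alone to the center of [j] would serve X by k centers at a strictly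
    smaller cost. *)
Lemma voronoi x j : x \in X -> sqnorm (x - center (cl x)) <= sqnorm (x - center j).
Proof.
move=> xX; rewrite leNgt; apply/negP => lt.
pose g y := if y == x then center j else center (cl y).
have : (Delta k X <= (\sum_(y <- X) sqnorm (y - g y))%:E)%E.
  rewrite -[X in Delta X](size_enum_ord k) -(size_map center).
  apply: Delta_le_assign => [|y _].
    by rewrite -size_eq0 size_map size_enum_ord -lt0n.
  by rewrite /g; case: ifP => _; apply: map_f; rewrite mem_enum.
rewrite Delta_optcost lee_fin leNgt => /negP; apply.
rewrite optcostE.
have le y : sqnorm (y - g y) <= sqnorm (y - center (cl y)).
  by rewrite /g; case: eqP => // ->; apply: ltW.
rewrite -subr_gt0 -sumrB (perm_big _ (perm_to_rem xX)) big_cons /=.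
apply: ltr_pwDl; first by rewrite /g eqxx subr_gt0.
by apply: sumr_ge0 => y _; rewrite subr_ge0.
Qed.

(* Rerouting cluster i to the center of j leaves k - 1 centers. *)
Lemma center_separation i j : i != j ->
  eps * optcost <= csize i * sqnorm (center i - center j).
Proof.
move=> ij; pose g y := if cl y == i then center j else center (cl y).
pose C := [seq center l | l <- enum 'I_k & l != i].
have szC : size C = (k - 1)%N.
  rewrite size_map size_filter; have := count_predC (pred1 i) (enum 'I_k).
  rewrite (count_uniq_mem _ (enum_uniq _)) mem_enum size_enum_ord add1n => E.
  by rewrite -[X in (X - 1)%N]E subn1; apply: eq_count.
have CP l : l != i -> center l \in C.
  by move=> li; apply: map_f; rewrite mem_filter li mem_enum.
have C0 : C != [::] by apply/eqP => E; have := CP j; rewrite E eq_sym ij => /(_ isT).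
have := @Delta_le_assign C g C0; rewrite szC => H.
have {H} /H H : forall x, x \in X -> g x \in C.
  by move=> x _; rewrite /g; case: ifPn => [_|]; apply: CP; rewrite // eq_sym.
have := le_trans irr H; rewrite Delta_optcost lee_fin.
(* Only cluster i changes its cost, and the parallel-axis identity gives the increase. *)
have -> : \sum_(x <- X) sqnorm (x - g x) =
    optcost + csize i * sqnorm (center i - center j).
  rewrite sum_by_cluster /optcost (bigD1 i) //= [in RHS](bigD1 i) //=.
  rewrite addrAC; congr (_ + _); last first.
    apply: eq_bigr => l li; apply: eq_bigr => x /eqP xl.
    by rewrite /g xl (negbTE li).
  by rewrite -cluster_sqnorm; apply: eq_bigr => x xi; rewrite /g xi.
by lra.
Qed.

Definition close (c : point) (j : 'I_k) : Prop :=
  csize j * sqnorm (c - center j) <= eps / 16 * ccost j.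

Lemma close_cost c j : close c j ->
  \sum_(x <- X | cl x == j) sqnorm (x - c) <= (1 + eps / 16) * ccost j.
Proof. by rewrite /close sqnormB cluster_sqnorm; lra. Qed.

(** The second clause keeps all centers away from uncovered clusters, the third bounds the cost of
    covered ones. Distinctness of the labels is recorded in [wf_state]. *)
Definition good_state (RC : seq point * seq point) : Prop :=
  [/\ {subset RC.1 <= X},
      forall c, c \in RC.2 -> exists2 j, j \in map cl RC.1 & close c j &
      forall j, j \in map cl RC.1 -> exists2 c, c \in RC.2 & close c j].

Definition cweight (C : seq point) (j : 'I_k) : R :=
  \sum_(x <- X | cl x == j) weight C x.

Lemma cweight_ge0 C j : 0 <= cweight C j.
Proof. by apply: sumr_ge0 => x _; apply: weight_ge0. Qed.

Lemma weight_sumE C : weight_sum X C = \sum_j cweight C j.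
Proof. exact: sum_by_cluster. Qed.

Lemma covered_cweight RC j : good_state RC -> j \in map cl RC.1 ->
  cweight RC.2 j <= (1 + eps / 16) * ccost j.
Proof.
case=> _ _ cov /cov[c cC /close_cost]; apply: le_trans.
by apply: ler_sum => x _; apply: weight_le.
Qed.

(** The nearest center c of x stands for some other cluster j. With D the squared distance of the
    two centroids, closeness and separation put c within D / 16 of the centroid of j, and [voronoi]
    keeps x at least D / 4 from it. So x pays at least D / 16, while the average cost of its cluster
    is at most its optimal average plus 25 D / 16. *)
Lemma uncovered_weight RC x : good_state RC -> x \in X -> cl x \notin map cl RC.1 ->
  eps / 32 * cweight RC.2 (cl x) <= csize (cl x) * weight RC.2 x.
Proof.
case=> RX good _ xX xR; have e_gt0 := eps_gt0; have e_le := eps_le.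
have m1 := csize_ge1 xX; set i := cl x in xR m1 *.
(* Without centers all weights are 1, and eps / 32 <= 1 suffices. *)
have [E|C0] := eqVneq RC.2 [::].
  by rewrite E /cweight csizeE /weight mulr1; nra.
have [c cC wE] := weight_attained x C0.
have [j jR cj] := good c cC.
have ij : i != j by apply: contraNneq xR => ->.
have mj1 : 1 <= csize j by have /mapP[y /RX yX ->] := jR; apply: csize_ge1.
have sep1 := center_separation ij.
have sep2 : eps * optcost <= csize j * sqnorm (center i - center j).
  by rewrite sqnormB; apply: center_separation; rewrite eq_sym.
have vi := ccost_le_optcost i; have vj := ccost_le_optcost j.
have vor := voronoi j xX; rewrite -/i in vor.
set D := sqnorm (center i - center j) in sep1 sep2.
have D0 : 0 <= D by apply: sqnorm_ge0.
have cjD : sqnorm (c - center j) <= D / 16.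
  rewrite -(ler_pM2l (_ : 0 < csize j)); last by lra.
  by apply: le_trans cj _; nra.
have xD : D <= 4 * sqnorm (x - center j).
  have := sqnormD_le (center i - x) (x - center j) ltr01.
  by rewrite addrA subrK -/D (sqnormB _ x); lra.
have xcD : D / 16 <= sqnorm (x - c).
  have := sqnormD_le (x - c) (c - center j) ltr01.
  by rewrite addrA subrK; lra.
have icD : sqnorm (center i - c) <= 25 / 16 * D.
  (* The parameter 1 / 4 balances D against D / 16: (5 / 4) D + 5 D / 16 = 25 D / 16. *)
  have q4 : 0 < (4^-1 : R) by lra.
  have := sqnormD_le (center i - center j) (center j - c) q4.
  by rewrite addrA subrK -/D (sqnormB _ c) invrK; lra.
have cw : cweight RC.2 i <= ccost i + csize i * (25 / 16 * D).
  apply: (@le_trans _ _ (\sum_(y <- X | cl y == i) sqnorm (y - c))).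
    by apply: ler_sum => y _; apply: weight_le.
  by rewrite cluster_sqnorm lerD2l ler_wpM2l // csize_ge0.
rewrite wE; apply: (@le_trans _ _ (csize i * (D / 16))); last first.
  by rewrite ler_wpM2l // csize_ge0.
have := ler_wpM2l (_ : 0 <= eps / 32) cw => /(_ ltac:(lra)) /le_trans; apply.
set P := csize i * D in sep1 *.
have -> : csize i * (25 / 16 * D) = 25 / 16 * P by rewrite /P; ring.
have -> : csize i * (D / 16) = P / 16 by rewrite /P; ring.
have P0 : 0 <= P by rewrite mulr_ge0 ?csize_ge0.
have : eps * ccost i <= P by apply: le_trans sep1; rewrite ler_pM2l.
by nra.
Qed.

Lemma weight_sum_gt0 C : ~~ (Phi C X <= (1 + eps)%:E * Delta k X)%E ->
  0 < weight_sum X C.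
Proof.
rewrite Delta_optcost -EFinM.
have [->|C0] := eqVneq C [::].
  move=> _; rewrite /weight_sum /= big_const_seq count_predT iter_addr addr0.
  by rewrite ltr0n lt0n size_eq0.
rewrite Phi_weight // lee_fin -ltNge; apply: le_lt_trans.
by rewrite mulr_ge0 ?optcost_ge0 //; have := eps_gt0; lra.
Qed.

(** Covered clusters cost at most (1 + eps / 16) times the optimum while the total exceeds (1 + eps)
    times it. The uncovered share is thus at least (15 / 16) eps / (1 + eps), and 1 + eps <= 3 /
    2. *)
Lemma uncovered_mass RC : good_state RC ->
  ~~ (Phi RC.2 X <= (1 + eps)%:E * Delta k X)%E ->
  5 / 8 * eps * weight_sum X RC.2 <= \sum_(j | j \notin map cl RC.1) cweight RC.2 j.
Proof.
move=> good bad; have W0 := weight_sum_gt0 bad.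
have e_gt0 := eps_gt0; have e_le := eps_le.
have [E|C0] := eqVneq RC.2 [::].
  have -> : \sum_(j | j \notin map cl RC.1) cweight RC.2 j = weight_sum X RC.2.
    rewrite weight_sumE; apply: eq_bigl => j; apply/negP => jR.
    by case: good => _ _ /(_ j jR) [c]; rewrite E.
  by nra.
move: bad; rewrite Delta_optcost -EFinM Phi_weight // lee_fin -ltNge.
rewrite -/(weight_sum X RC.2) weight_sumE (bigID (fun j => j \in map cl RC.1)) /=.
set cov := \sum_(j | j \in _) _; set unc := \sum_(j | j \notin _) _.
have : cov <= (1 + eps / 16) * optcost.
  rewrite /optcost mulr_sumr [leRHS](bigID (fun j => j \in map cl RC.1)) /=.
  rewrite -[leLHS]addr0; apply: lerD.
    by apply: ler_sum => j jR; apply: covered_cweight.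
  apply: sumr_ge0 => j _; rewrite mulr_ge0 ?ccost_ge0 //; lra.
have unc0 : 0 <= unc by apply: sumr_ge0 => j _; apply: cweight_ge0.
by have := optcost_ge0; nra.
Qed.

Lemma all_covered RC : good_state RC -> (forall j, j \in map cl RC.1) ->
  (Phi RC.2 X <= (1 + eps)%:E * Delta k X)%E.
Proof.
move=> good cov.
have C0 : RC.2 != [::].
  case: good => _ _ /(_ _ (cov (Ordinal k_gt0))) [c cC _].
  by apply: contraTneq cC => ->.
rewrite Delta_optcost -EFinM Phi_weight // lee_fin -/(weight_sum X RC.2) weight_sumE.
apply: (@le_trans _ _ ((1 + eps / 16) * optcost)).
  by rewrite mulr_sumr; apply: ler_sum => j _; apply: covered_cweight.
by rewrite ler_wpM2r ?optcost_ge0 //; have := eps_gt0; lra.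
Qed.

End OptimalClustering.

(** * Success probability *)

Section SuccessProbability.
Variables (R : realType) (d n k : nat) (cl : 'rV[R]_d -> 'I_k).
Variables (eps : R) (X : seq 'rV[R]_d).
Hypotheses (d_gt0 : (0 < d)%N) (n_gt0 : (0 < n)%N) (k_gt0 : (0 < k)%N).
Hypotheses (sX : size X = n) (eps_gt0 : 0 < eps) (eps_le : eps <= 1 / 2).
Hypothesis irr : irreducible k eps X.
Hypothesis opt : optimal_clustering X cl.
Local Notation point := 'rV[R]_d.
Local Notation same := (same_cluster cl).
Local Notation expect := (expect same).
Local Notation csize := (csize cl X).
Local Notation cweight := (cweight cl X).
Local Notation center := (center cl X).
Local Notation ccost := (ccost cl X).
Local Notation close := (close cl eps X).
Local Notation good_state := (good_state cl eps X).
Local Notation N := (constN k eps).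
Local Notation L := (constL k eps).
Local Notation step := (kmeans_step k eps X).

Let X_neq0 : X != [::].
Proof. by rewrite -size_eq0 sX -lt0n. Qed.

Let kR_ge1 : 1 <= k%:R :> R.
Proof. by rewrite ler1n. Qed.

(** * Sample counts and the effect of one thinning step *)

Section Sampling.
Variable C : seq point.
Hypotheses (sC : (size C <= k)%N) (W_gt0 : 0 < weight_sum X C).
Local Notation W := (weight_sum X C).

Let W_neq0 : W != 0. Proof. by rewrite gt_eqF. Qed.

Let sum_probs : \sum_(x <- X) weight C x / W = 1.
Proof. by rewrite -mulr_suml divff. Qed.

Definition mass (a : pred point) : R := \sum_(x <- X | a x) weight C x / W.

(** Each draw adds an indicator of variance mass (1 - mass), which is at most the mass. *)
Lemma d2samples_variance (a : pred point) m :
  expect (fun S => ((count a S)%:R - m%:R * mass a) ^+ 2) (d2samples X C m)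
    <= m%:R * mass a.
Proof.
have massE : mass a = \sum_(x <- X) weight C x / W * (a x)%:R.
  rewrite /mass big_mkcond; apply: eq_bigr => x _.
  by case: (a x); rewrite ?mulr1 ?mulr0.
have := @expect_iterM_variance R d same _
  (fun S => let* x := d2sample X C in Ret (x :: S))
  (fun S => (count a S)%:R) (fun=> True) (mass a) (mass a) m [::].
rewrite /= => H.
have {H} := H _ _ _ I.
under eq_expect do rewrite subr0.
apply.
- move=> S _; apply: valid_bind (spec_valid (spec_d2sample cl d_gt0 k_gt0 sX n_gt0 sC)) _.
  by [].
- move=> S _; rewrite expect_bind expect_d2sample //=.
  rewrite (eq_bigr (fun x => weight C x / W * (a x)%:R -
    mass a * (weight C x / W))).
    by rewrite big_split /= sumrN -mulr_sumr sum_probs -massE mulr1 subrr.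
  by move=> x _; rewrite natrD; ring.
- move=> S _; rewrite expect_bind expect_d2sample //=.
  rewrite (eq_bigr (fun x => (1 - 2 * mass a) * (weight C x / W * (a x)%:R) +
    mass a ^+ 2 * (weight C x / W))).
    rewrite big_split /= -!mulr_sumr sum_probs -massE.
    by have := sqr_ge0 (mass a); lra.
  by move=> x _; rewrite natrD; case: (a x) => /=; ring.
Qed.

Lemma mass_cluster j : mass (fun x => cl x == j) = cweight C j / W.
Proof. by rewrite /mass -mulr_suml. Qed.

(** Without truncation at 1, the chance of drawing x is proportional to its weight and the chance of
    keeping it inversely so. The weight of x cancels, which makes the thinned sample uniform on the
    cluster. *)
Lemma thinning_expect s T (f : seq point -> R) :
  {in X, forall x, cl x = cl s ->
    0 < weight C x /\ eps / 128 * weight C s <= weight C x} ->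
  expect f (thinning_step eps X C s T) =
  f T + eps / 128 * weight C s / W *
    \sum_(x <- X | cl x == cl s) (f (x :: T) - f T).
Proof.
move=> small; rewrite expect_thinning_step //.
have E : f T = \sum_(x <- X) f T * (weight C x / W).
  by rewrite -mulr_sumr sum_probs mulr1.
rewrite [X in X + _]E mulr_sumr [X in _ + X]big_mkcond.
rewrite -big_split /= !big_seq; apply: eq_bigr => x xX.
case: eqP => [xs|_]; last by rewrite addr0 mulrC.
have [wx0 le] := small x xX xs.
have -> : keep_prob eps C s x = eps / 128 * (weight C s / weight C x).
  by rewrite /keep_prob min_r // mulrA ler_pdivrMr // mul1r.
by field; rewrite W_neq0 gt_eqF.
Qed.

End Sampling.

Section GoodSeed.
Variable RC : seq point * seq point.
Hypotheses (sC : (size RC.2 <= k)%N) (good : good_state RC).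
Hypothesis bad : ~~ (Phi RC.2 X <= (1 + eps)%:E * Delta k X)%E.
Local Notation C := RC.2.
Local Notation W := (weight_sum X C).

Let W_gt0 : 0 < W.
Proof. exact: (weight_sum_gt0 X_neq0 eps_gt0 opt bad). Qed.

Definition good_seed (s : point) : Prop :=
  [/\ s \in X, cl s \notin map cl RC.1,
      eps / (8 * k%:R) * W <= cweight C (cl s) &
      csize (cl s) * weight C s <= 4 * cweight C (cl s)].

(** * The sample drawn from the cluster of a good seed *)

Section Thinning.
Variable s : point.
Hypothesis seed : good_seed s.
Local Notation j := (cl s).

(** The probability that one round adds a given point of the cluster; [ET] is then the expected size
    of T. *)
Let alpha : R := eps / 128 * weight C s / W.
Let ET : R := L%:R * (alpha * csize j).

Let m_ge1 : 1 <= csize j.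
Proof. by case: seed => sX' _ _ _; apply: csize_ge1. Qed.

Let cw_gt0 : 0 < cweight C j.
Proof.
case: seed => _ _ h _; apply: lt_le_trans h.
by rewrite mulr_gt0 // divr_gt0 // mulr_gt0 // ltr0n.
Qed.

(** The seed weighs at most four times the cluster average and every point at least eps / 32 times
    it. The factor eps / 128 is chosen to bridge these two. *)
Let small : {in X, forall x, cl x = cl s ->
    0 < weight C x /\ eps / 128 * weight C s <= weight C x}.
Proof.
move=> x xX xs; case: seed => s_X sR hw low; rewrite -xs in sR.
have := uncovered_weight k_gt0 eps_gt0 eps_le irr opt good xX sR; rewrite xs => up.
have := eps_gt0; have := cw_gt0; have := m_ge1; have := weight_ge0 C x => *.
split.
  have : 0 < csize j * weight C x by apply: lt_le_trans up; rewrite mulr_gt0 // divr_gt0.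
  by rewrite pmulr_rgt0 //; lra.
rewrite -(ler_pM2l (_ : 0 < csize j)); last by lra.
by apply: le_trans up; nra.
Qed.

(** The factors eps / 128, eps / 32 and eps / (8 k) multiply to eps^3 / (2^15 k), a lower bound on
    the chance that a round adds a point; L is 2^8 k / eps times its inverse. *)
Let ET_ge : 256 * k%:R / eps <= ET.
Proof.
have /andP[hL _] := constL_bounds k_gt0 eps_gt0 eps_le.
case: seed => s_X sR hw _.
have up := uncovered_weight k_gt0 eps_gt0 eps_le irr opt good s_X sR.
have e0 := eps_gt0; have k1 := kR_ge1; have W0 := W_gt0.
have a_ge : eps ^+ 3 / (2 ^+ 15 * k%:R) <= alpha * csize j.
  have -> : alpha * csize j = eps / 128 / W * (csize j * weight C s).
    by rewrite /alpha; field; rewrite gt_eqF.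
  have -> : eps ^+ 3 / (2 ^+ 15 * k%:R) =
      eps / 128 / W * (eps / 32 * (eps / (8 * k%:R) * W)).
    by field; rewrite ?gt_eqF //; lra.
  rewrite ler_pM2l ?divr_gt0 //; apply: le_trans up.
  by rewrite ler_pM2l ?divr_gt0.
have -> : 256 * k%:R / eps = 2 ^+ 23 * k%:R ^+ 2 / eps ^+ 4 * (eps ^+ 3 / (2 ^+ 15 * k%:R)).
  by field; rewrite ?gt_eqF //; lra.
apply: ler_pM => //.
  by rewrite divr_ge0 ?mulr_ge0 ?exprn_ge0 ?ler0n // ltW.
by rewrite divr_ge0 ?mulr_ge0 ?exprn_ge0 ?ler0n // ltW.
Qed.

Let ET_gt0 : 0 < ET.
Proof.
have e0 := eps_gt0; have k1 := kR_ge1.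
by apply: lt_le_trans ET_ge; apply: divr_gt0; lra.
Qed.

Let valid_thin T :
  valid same (fun=> True) (thinning_step eps X C s T).
Proof.
exact: valid_imp (spec_valid (spec_thinning_step cl d_gt0 n_gt0 k_gt0 sX eps_gt0 s T sC)).
Qed.

Lemma sample_size_variance :
  expect (fun T => ((size T)%:R - ET) ^+ 2) (uniform_sample k eps X C s) <= ET.
Proof.
have := @expect_iterM_variance R d same _ (thinning_step eps X C s)
  (fun T => (size T)%:R) (fun=> True) (alpha * csize j) (alpha * csize j) L [::].
rewrite -/ET => H; have {H} := H _ _ _ I.
under eq_expect do rewrite subr0.
apply; first by move=> T _; apply: valid_thin.
- move=> T _; rewrite thinning_expect //.
  rewrite (eq_bigr (fun=> 1)); last by move=> x _; rewrite /= -natr1; ring.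
  by rewrite csizeE /= -/alpha; ring.
- move=> T _; rewrite thinning_expect //.
  rewrite (eq_bigr (fun=> (1 - 2 * (alpha * csize j)) * 1)); last first.
    by move=> x _; rewrite /= -natr1; ring.
  rewrite -mulr_sumr csizeE /= -/alpha.
  by have := sqr_ge0 (alpha * csize j); lra.
Qed.

Definition deviation (T : seq point) : point := \sum_(x <- T) (x - center j).

(** Applied coordinatewise: an increment has mean zero because the points of the cluster deviate
    from their centroid by a total of 0. *)
Lemma deviation_variance :
  expect (fun T => sqnorm (deviation T)) (uniform_sample k eps X C s)
    <= L%:R * (alpha * ccost j).
Proof.
rewrite /sqnorm expect_sum.
have -> : L%:R * (alpha * ccost j) = \sum_(i < d) L%:R * (alpha *
    \sum_(x <- X | cl x == j) ((x - center j) 0 i) ^+ 2).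
  rewrite -mulr_sumr; congr (_ * _); rewrite -mulr_sumr; congr (_ * _).
  by rewrite exchange_big.
apply: ler_sum => i _.
have dev0 : \sum_(x <- X | cl x == j) (x - center j) 0 i = 0.
  rewrite -big_filter.
  have := congr1 (fun v : 'rV_d => v 0 i) (sum_sub_mean (cluster_of X cl j)).
  by rewrite summxE mxE.
have := @expect_iterM_variance R d same _ (thinning_step eps X C s)
  (fun T => deviation T 0 i) (fun=> True) 0
  (alpha * \sum_(x <- X | cl x == j) ((x - center j) 0 i) ^+ 2) L [::].
move=> H; have {H} := H _ _ _ I.
have dnil : deviation [::] 0 i = 0 by rewrite /deviation big_nil mxE.
have dcons x T : deviation (x :: T) 0 i = (x - center j) 0 i + deviation T 0 i.
  by rewrite /deviation big_cons mxE.
under eq_expect do rewrite dnil mulr0 !subr0.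
apply; first by move=> T _; apply: valid_thin.
- move=> T _; rewrite thinning_expect //.
  rewrite (eq_bigr (fun x => (x - center j) 0 i)); last first.
    by move=> x _; rewrite dcons; ring.
  by rewrite dev0; ring.
- move=> T _; rewrite thinning_expect //.
  rewrite (eq_bigr (fun x => ((x - center j) 0 i) ^+ 2)); last first.
    by move=> x _; rewrite dcons; ring.
  by rewrite -/alpha; lra.
Qed.

Lemma mean_sub_center T : T != [::] ->
  mean T - center j = (size T)%:R^-1 *: deviation T.
Proof.
move=> T0; rewrite /deviation big_split /= sumrN scalerBr -/(mean T).
rewrite big_const_seq count_predT iter_addr addr0 -scaler_nat scalerA mulVf ?scale1r //.
by rewrite pnatr_eq0 size_eq0.
Qed.

(** Two normalised squared deviations. A bad T makes one of them at least 1, so 1 minus the penalty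
    is a lower bound for the indicator of success. When [ccost j] is 0, division by 0 makes the
    second term 0. *)
Definition thinning_penalty (T : seq point) : R :=
  4 / ET ^+ 2 * ((size T)%:R - ET) ^+ 2 +
  64 * csize j / (eps * ccost j * ET ^+ 2) * sqnorm (deviation T).

Let coef_ge0 : 0 <= 64 * csize j / (eps * ccost j * ET ^+ 2).
Proof.
apply: divr_ge0; first by rewrite mulr_ge0 // csize_ge0.
by rewrite mulr_ge0 ?sqr_ge0 // mulr_ge0 ?ccost_ge0 // ltW.
Qed.

Lemma thinning_penalty_ge0 T : 0 <= thinning_penalty T.
Proof.
have e0 := eps_gt0.
rewrite /thinning_penalty; apply: addr_ge0.
  by rewrite mulr_ge0 ?sqr_ge0 // divr_ge0 ?sqr_ge0.
by rewrite mulr_ge0 ?sqnorm_ge0 //.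
Qed.

(** The variances turn the two terms into 4 / E and at most 64 / (eps E), that is at most 1 / (128
    k) and 1 / (4 k). *)
Lemma thinning_penalty_mean :
  expect thinning_penalty (uniform_sample k eps X C s) <= 5 / (16 * k%:R).
Proof.
have e0 := eps_gt0; have e1 := eps_le; have k1 := kR_ge1; have E0 := ET_gt0.
have m1 := m_ge1.
rewrite expectD !expectZ.
apply: (@le_trans _ _ (4 / ET ^+ 2 * ET +
  64 * csize j / (eps * ccost j * ET ^+ 2) * (L%:R * (alpha * ccost j)))).
  apply: lerD; apply: ler_wpM2l.
  - by rewrite divr_ge0 ?sqr_ge0.
  - exact: sample_size_variance.
  - exact: coef_ge0.
  - exact: deviation_variance.
have V : 64 * csize j / (eps * ccost j * ET ^+ 2) * (L%:R * (alpha * ccost j))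
    <= 64 / (eps * ET).
  have [->|V0] := eqVneq (ccost j) 0.
    by rewrite !mulr0 ltW // divr_gt0 // mulr_gt0.
  rewrite -subr_ge0 -[leRHS](_ : 0 = _) //.
  have -> : 64 * csize j / (eps * ccost j * ET ^+ 2) * (L%:R * (alpha * ccost j)) =
      64 / (eps * ET ^+ 2) * ET.
    by rewrite {3}/ET; field; rewrite V0 !gt_eqF.
  by field; rewrite !gt_eqF.
have h1 : 4 / ET ^+ 2 * ET = 4 / ET by field; rewrite gt_eqF.
have iE : ET^-1 <= eps / (256 * k%:R).
  have c0 : 0 < 256 * k%:R / eps by apply: divr_gt0; lra.
  by rewrite -invf_div lef_pV2 ?posrE.
have h2 : 64 / (eps * ET) = 64 / eps * ET^-1 by field; rewrite !gt_eqF.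
have h3 : 64 / eps * ET^-1 <= 1 / (4 * k%:R).
  have -> : 1 / (4 * k%:R) = 64 / eps * (eps / (256 * k%:R)).
    by field; rewrite !gt_eqF //; lra.
  by rewrite ler_pM2l // divr_gt0.
have ik : 0 < k%:R^-1 :> R by rewrite invr_gt0; lra.
have h4 : 4 / ET <= 1 / (128 * k%:R).
  apply: le_trans (ler_wpM2l _ iE) _ => //.
  rewrite !invfM mulrA mul1r; have := ler_wpM2r (ltW ik) e1; lra.
rewrite h1; apply: le_trans (lerD h4 (le_trans V _)) _; first by rewrite h2; exact: h3.
by rewrite !invfM; lra.
Qed.

Lemma thinning_penalty_ge1 T :
  (forall x, x \in T -> x \in X /\ cl x = j) ->
  ~ (constM k eps <= (size T)%:R /\ close (mean T) j) -> 1 <= thinning_penalty T.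
Proof.
move=> TX notgood; have e0 := eps_gt0; have k1 := kR_ge1; have E0 := ET_gt0.
have m1 := m_ge1.
have p1 : 0 <= 4 / ET ^+ 2 * ((size T)%:R - ET) ^+ 2.
  by rewrite mulr_ge0 ?sqr_ge0 // divr_ge0 ?sqr_ge0.
have p2 : 0 <= 64 * csize j / (eps * ccost j * ET ^+ 2) * sqnorm (deviation T).
  by rewrite mulr_ge0 ?sqnorm_ge0.
have [lt|ge] := ltP ((size T)%:R) (ET / 2).
  rewrite /thinning_penalty -[leLHS]addr0; apply: lerD => //.
  rewrite mulrAC ler_pdivlMr ?exprn_gt0 // mul1r.
  by nra.
have sT : 0 < (size T)%:R :> R by apply: lt_le_trans ge; lra.
have T0 : T != [::] by rewrite -size_eq0 -(pnatr_eq0 R) gt_eqF.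
(* Half of the expected size is still 128 k / eps, twice the threshold M; hence only the distance of
   the mean can fail. *)
have sM : constM k eps <= (size T)%:R.
  apply: le_trans ge; apply: le_trans (_ : 256 * k%:R / eps / 2 <= _); last first.
    by have := ET_ge; lra.
  rewrite /constM -!mulrA; have : 0 < k%:R / eps by rewrite divr_gt0 //; lra.
  by lra.
have ncl : ~ close (mean T) j by move=> h; apply: notgood.
move: ncl; rewrite /close => /negP; rewrite -ltNge mean_sub_center // sqnormZ => far.
have {}far : eps / 16 * ccost j * (ET / 2) ^+ 2 < csize j * sqnorm (deviation T).
  apply: (@le_lt_trans _ _ (eps / 16 * ccost j * (size T)%:R ^+ 2)).
    apply: ler_wpM2l; first by rewrite mulr_ge0 ?ccost_ge0 // divr_ge0 // ltW.
    by rewrite ler_pXn2r ?nnegrE //; lra.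
  rewrite -ltr_pdivlMr ?exprn_gt0 //; apply: lt_le_trans far _.
  by rewrite exprVn mulrCA mulrC.
(* In a cluster of cost 0 all points equal the centroid, so the deviation is 0 and the strict
   inequality [far] is impossible. *)
have [V0|V0] := eqVneq (ccost j) 0.
  have zero x : x \in T -> x - center j = 0.
    move=> /TX[xX xj]; have : sqnorm (x - center j) = 0.
      apply/eqP; rewrite eq_le sqnorm_ge0 andbT -V0 /ccost (perm_big _ (perm_to_rem xX)).
      rewrite big_cons xj eqxx lerDl; apply: sumr_ge0 => y _; exact: sqnorm_ge0.
    move=> /eqP; rewrite psumr_eq0 => [|i _]; last exact: sqr_ge0.
    move=> /allP z; apply/rowP => i; have := z i; rewrite mem_index_enum => /(_ isT).
    by rewrite /= sqrf_eq0 => /eqP ->; rewrite mxE.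
  have D0 : deviation T = 0 by rewrite /deviation big_seq big1.
  move: far; rewrite D0 V0 mulr0 mul0r.
  have -> : sqnorm (0 : point) = 0.
    by rewrite /sqnorm big1 // => i _; rewrite mxE expr0n.
  by rewrite mulr0 ltxx.
have V1 : 0 < ccost j by rewrite lt_def V0 ccost_ge0.
rewrite /thinning_penalty -[leLHS]add0r; apply: lerD => //.
have D0 : 0 < eps * ccost j * ET ^+ 2 by rewrite mulr_gt0 ?exprn_gt0 // mulr_gt0.
rewrite mulrAC ler_pdivlMr // mul1r.
have -> : eps * ccost j * ET ^+ 2 = 64 * (eps / 16 * ccost j * (ET / 2) ^+ 2).
  by move: ET => E; field.
by rewrite -[leRHS]mulrA ler_pM2l // ltW.
Qed.

End Thinning.

(** * The choice of the seed *)

Let Nlow : 2 ^+ 12 * k%:R ^+ 3 / eps ^+ 2 <= N%:R.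
Proof. by have /andP[] := constN_bounds k_gt0 eps_gt0 eps_le. Qed.

Let N_gt0 : 0 < N%:R :> R.
Proof. by rewrite ltr0n (leq_trans k_gt0) // constN_ge. Qed.

(** Pigeonhole on [uncovered_mass]: the average over k clusters is 5 eps / (8 k), and asking for
    half of it makes the contradiction strict. *)
Lemma exists_popular_cluster : exists2 j, j \notin map cl RC.1 &
  5 * eps / (16 * k%:R) <= cweight C j / W.
Proof.
apply: contrapT => H.
have small i : i \notin map cl RC.1 -> cweight C i <= 5 * eps / (16 * k%:R) * W.
  move=> iR; rewrite leNgt; apply/negP => lt; apply: H; exists i => //.
  by rewrite ler_pdivlMr // ltW.
have := uncovered_mass X_neq0 eps_gt0 eps_le opt good bad.
have k1 := kR_ge1; have e0 := eps_gt0; have W0 := W_gt0.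
have : \sum_(i | i \notin map cl RC.1) cweight C i <= 5 * eps / 16 * W.
  apply: le_trans (ler_sum _ small) _.
  apply: (@le_trans _ _ (\sum_(i < k) 5 * eps / (16 * k%:R) * W)).
    rewrite [leRHS](bigID (fun i => i \notin map cl RC.1)) /= lerDl.
    by apply: sumr_ge0 => i _; rewrite !mulr_ge0 // ?invr_ge0 ?mulr_ge0 ?ltW //; lra.
  rewrite sumr_const card_ord -[_ *+ _]mulr_natr le_eqVlt; apply/orP; left; apply/eqP.
  by field; rewrite gt_eqF //; lra.
have : 0 < eps * W by rewrite mulr_gt0.
by nra.
Qed.

Definition low (j : 'I_k) : pred point :=
  fun x => (cl x == j) && (csize j * weight C x <= 4 * cweight C j).

(* Less than a quarter of the points of a cluster have weight above four    *)
(* times the average, and by uncovered_weight the remaining ones carry a    *)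
(* fraction of at least eps / 64 of its weight.                             *)
Lemma mass_low j : j \notin map cl RC.1 -> 0 < cweight C j ->
  eps / 64 * (cweight C j / W) <= mass C (low j).
Proof.
move=> jR cw0; have e0 := eps_gt0; have W0 := W_gt0.
rewrite /mass -mulr_suml mulrA ler_pM2r ?invr_gt0 //.
have m0 : 0 < csize j.
  rewrite lt_def csize_ge0 andbT; apply/negP => /eqP m0.
  move: cw0; rewrite /cweight -big_filter.
  have -> : [seq x <- X | cl x == j] = [::].
    by apply/eqP; rewrite -size_eq0 -(pnatr_eq0 R); apply/eqP.
  by rewrite big_nil ltxx.
pose hi x := (cl x == j) && ~~ (csize j * weight C x <= 4 * cweight C j).
have split1 : \sum_(x <- X | low j x) 1 + \sum_(x <- X | hi x) 1 = csize j.
  by rewrite -csizeE [RHS](bigID (fun x => csize j * weight C x <= 4 * cweight C j)).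
have hi_le : 4 * cweight C j * \sum_(x <- X | hi x) 1 <= csize j * cweight C j.
  apply: (@le_trans _ _ (\sum_(x <- X | hi x) csize j * weight C x)).
    rewrite mulr_sumr; apply: ler_sum => x /andP[_].
    by rewrite -ltNge mulr1 => /ltW.
  rewrite -mulr_sumr ler_wpM2l ?csize_ge0 // /cweight.
  rewrite [leRHS](bigID (fun x => csize j * weight C x <= 4 * cweight C j)) /= lerDr.
  by apply: sumr_ge0 => x _; apply: weight_ge0.
have hi4 : 4 * \sum_(x <- X | hi x) 1 <= csize j.
  by rewrite -(ler_pM2r cw0); lra.
have lowm : csize j / 2 <= \sum_(x <- X | low j x) 1 by lra.
have lo_ge : eps / 32 * cweight C j * \sum_(x <- X | low j x) 1 <=
    csize j * \sum_(x <- X | low j x) weight C x.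
  rewrite [leLHS]mulr_sumr [leRHS]mulr_sumr big_seq_cond [leRHS]big_seq_cond.
  apply: ler_sum => x /and3P[xX /eqP xj _].
  have := uncovered_weight k_gt0 eps_gt0 eps_le irr opt good xX.
  by rewrite xj mulr1 => /(_ jR).
rewrite -(ler_pM2l m0); apply: le_trans lo_ge.
have : 0 < eps / 32 * cweight C j by rewrite mulr_gt0 // divr_gt0.
move=> /ltW/ler_wpM2l/(_ _ _ lowm); apply: le_trans.
by rewrite le_eqVlt; apply/orP; left; apply/eqP; field.
Qed.

Section Seed.
Variable p : 'I_k.
Hypotheses (pR : p \notin map cl RC.1)
  (popular : 5 * eps / (16 * k%:R) <= cweight C p / W).

Let Q (j : 'I_k) : R := cweight C j / W.
Let heavy (j : 'I_k) := eps / (8 * k%:R) <= Q j.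
Let cnt (j : 'I_k) (S : seq point) : R := (count (fun x => cl x == j) S)%:R.
Let cntlow (j : 'I_k) (S : seq point) : R := (count (low j) S)%:R.
(** In units of the gap, the popular cluster expects at least 10 samples and a light one fewer than
    4. A light cluster reaching half the expectation of the popular one overshoots by at least one
    unit. *)
Let gap : R := N%:R * (eps / (32 * k%:R)).

(** The terms detect, in turn, that the popular cluster gets at most half its expected samples, that
    some light cluster is oversampled, and that some heavy uncovered cluster has no low sample. *)
Definition seed_penalty (S : seq point) : R :=
  4 / (N%:R * Q p) ^+ 2 * (cnt p S - N%:R * Q p) ^+ 2 +
  (\sum_(j | ~~ heavy j) (gap ^+ 2)^-1 * (cnt j S - N%:R * Q j) ^+ 2 +
   \sum_(j | heavy j && (j \notin map cl RC.1))
     ((N%:R * mass C (low j)) ^+ 2)^-1 * (cntlow j S - N%:R * mass C (low j)) ^+ 2).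

Let Qp_gt0 : 0 < Q p.
Proof.
apply: lt_le_trans popular.
by rewrite divr_gt0 ?mulr_gt0 ?ltr0n.
Qed.

Let heavy_low_gt0 : 0 < eps ^+ 2 / (512 * k%:R).
Proof.
by have := kR_ge1; move=> k1; apply: divr_gt0; [exact: exprn_gt0|lra].
Qed.

Let heavy_low j : heavy j -> j \notin map cl RC.1 ->
  eps ^+ 2 / (512 * k%:R) <= mass C (low j).
Proof.
move=> hj jR; have e0 := eps_gt0; have k1 := kR_ge1.
have Q0 : 0 < Q j by apply: lt_le_trans hj; rewrite divr_gt0 // mulr_gt0 //; lra.
have cw0 : 0 < cweight C j by move: Q0; rewrite /Q pmulr_lgt0 // invr_gt0.
apply: le_trans (mass_low jR cw0).
have -> : eps ^+ 2 / (512 * k%:R) = eps / 64 * (eps / (8 * k%:R)).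
  by field; rewrite gt_eqF //; lra.
by rewrite ler_pM2l // divr_gt0.
Qed.

Lemma seed_penalty_ge0 S : 0 <= seed_penalty S.
Proof.
rewrite /seed_penalty; apply: addr_ge0.
  by rewrite mulr_ge0 ?sqr_ge0 // divr_ge0 ?sqr_ge0.
by apply: addr_ge0; apply: sumr_ge0 => j _;
  rewrite mulr_ge0 ?sqr_ge0 // invr_ge0 sqr_ge0.
Qed.

(** Each variance is at most the corresponding mean. The three parts contribute at most 1 / 64, 1 /
    64 and 1 / 8, each over k, which is below 3 / 16 over k. *)
Lemma seed_penalty_mean : expect seed_penalty (d2samples X C N) <= 3 / (16 * k%:R).
Proof.
have e0 := eps_gt0; have e1 := eps_le; have k1 := kR_ge1; have N0 := N_gt0.
have Q0 := Qp_gt0; have W0 := W_gt0.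
have kgt0 : 0 < k%:R :> R by lra.
have iN : N%:R^-1 <= eps ^+ 2 / (2 ^+ 12 * k%:R ^+ 3).
  have c0 : 0 < 2 ^+ 12 * k%:R ^+ 3 / eps ^+ 2.
    apply: divr_gt0; last exact: exprn_gt0.
    by apply: mulr_gt0; exact: exprn_gt0.
  by rewrite -invf_div lef_pV2 ?posrE.
have cheb j : expect (fun S => (cnt j S - N%:R * Q j) ^+ 2) (d2samples X C N) <= N%:R * Q j.
  by have := d2samples_variance sC W_gt0 (fun x => cl x == j) N; rewrite mass_cluster.
have chebl j : expect (fun S => (cntlow j S - N%:R * mass C (low j)) ^+ 2) (d2samples X C N)
    <= N%:R * mass C (low j).
  exact: d2samples_variance.
have k2 : 0 <= (k%:R ^+ 2)^-1 :> R by rewrite invr_ge0 exprn_ge0 // ltW.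
have kk2 : (k%:R ^+ 2)^-1 <= k%:R^-1 :> R.
  rewrite lef_pV2 ?posrE ?exprn_gt0 // expr2; nra.
rewrite expectD expectZ expectD !expect_sum.
have t1 : 4 / (N%:R * Q p) ^+ 2 *
    expect (fun S => (cnt p S - N%:R * Q p) ^+ 2) (d2samples X C N) <= 1 / 64 * k%:R^-1.
  apply: le_trans (ler_wpM2l _ (cheb p)) _; first by rewrite divr_ge0 ?sqr_ge0.
  have -> : 4 / (N%:R * Q p) ^+ 2 * (N%:R * Q p) = 4 * N%:R^-1 * (Q p)^-1.
    by field; rewrite !gt_eqF.
  have iQ : (Q p)^-1 <= 16 * k%:R / (5 * eps).
    have c0 : 0 < 5 * eps / (16 * k%:R) by rewrite divr_gt0 ?mulr_gt0.
    by rewrite -invf_div lef_pV2 ?posrE.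
  have a0 : 0 <= 4 * N%:R^-1 :> R by rewrite mulr_ge0 // invr_ge0 ltW.
  have b0 : 0 <= (Q p)^-1 by rewrite invr_ge0 ltW.
  apply: le_trans (ler_pM a0 b0 (ler_wpM2l (ler0n R 4) iN) iQ) _.
  have -> : 4 * (eps ^+ 2 / (2 ^+ 12 * k%:R ^+ 3)) * (16 * k%:R / (5 * eps)) =
      eps / 320 * (k%:R ^+ 2)^-1 by field; rewrite !gt_eqF.
  by nra.
have t2 : \sum_(j | ~~ heavy j) expect (fun S => (gap ^+ 2)^-1 *
    (cnt j S - N%:R * Q j) ^+ 2) (d2samples X C N) <= 1 / 64 * k%:R^-1.
  apply: (@le_trans _ _ (\sum_(j < k) (1 / 64 * (k%:R ^+ 2)^-1))); last first.
    rewrite sumr_const card_ord -[_ *+ _]mulr_natr le_eqVlt; apply/orP; left; apply/eqP.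
    by field; rewrite gt_eqF.
  rewrite [leRHS](bigID (fun j => ~~ heavy j)) /= -[leLHS]addr0; apply: lerD; last first.
    by apply: sumr_ge0 => j _; lra.
  apply: ler_sum => j; rewrite -ltNge => light; rewrite expectZ.
  have g0 : 0 < gap by rewrite mulr_gt0 // divr_gt0 // mulr_gt0.
  apply: le_trans (ler_wpM2l _ (cheb j)) _; first by rewrite invr_ge0 sqr_ge0.
  apply: (@le_trans _ _ ((gap ^+ 2)^-1 * (N%:R * (eps / (8 * k%:R))))).
    by rewrite ler_pM2l ?invr_gt0 ?exprn_gt0 // ler_pM2l // ltW.
  have -> : (gap ^+ 2)^-1 * (N%:R * (eps / (8 * k%:R))) = 128 * k%:R / eps * N%:R^-1.
    by rewrite /gap; field; rewrite !gt_eqF.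
  apply: le_trans (ler_wpM2l _ iN) _; first by rewrite divr_ge0 ?mulr_ge0 ?ltW.
  have -> : 128 * k%:R / eps * (eps ^+ 2 / (2 ^+ 12 * k%:R ^+ 3)) =
      eps / 32 * (k%:R ^+ 2)^-1 by field; rewrite !gt_eqF.
  by nra.
(* This term dictates N: one factor k comes from the share of a heavy cluster, one from the sum over
   clusters, and one from the union bound over the iterations. *)
have t3 : \sum_(j | heavy j && (j \notin map cl RC.1)) expect (fun S =>
    ((N%:R * mass C (low j)) ^+ 2)^-1 *
    (cntlow j S - N%:R * mass C (low j)) ^+ 2) (d2samples X C N) <= 1 / 8 * k%:R^-1.
  apply: (@le_trans _ _ (\sum_(j < k) (1 / 8 * (k%:R ^+ 2)^-1))); last first.
    rewrite sumr_const card_ord -[_ *+ _]mulr_natr le_eqVlt; apply/orP; left; apply/eqP.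
    by field; rewrite gt_eqF.
  rewrite [leRHS](bigID (fun j => heavy j && (j \notin map cl RC.1))) /= -[leLHS]addr0.
  apply: lerD; last by apply: sumr_ge0 => j _; lra.
  apply: ler_sum => j /andP[hj jR]; rewrite expectZ.
  have ml := heavy_low hj jR.
  have m0 : 0 < mass C (low j).
    by apply: lt_le_trans ml; exact: heavy_low_gt0.
  apply: le_trans (ler_wpM2l _ (chebl j)) _; first by rewrite invr_ge0 sqr_ge0.
  have -> : ((N%:R * mass C (low j)) ^+ 2)^-1 * (N%:R * mass C (low j)) =
      N%:R^-1 * (mass C (low j))^-1 by field; rewrite !gt_eqF.
  have im : (mass C (low j))^-1 <= 512 * k%:R / eps ^+ 2.
    have c0 := heavy_low_gt0.
    by rewrite -invf_div lef_pV2 ?posrE.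
  have a0 : 0 <= N%:R^-1 :> R by rewrite invr_ge0 ltW.
  have b0 : 0 <= (mass C (low j))^-1 by rewrite invr_ge0 ltW.
  apply: le_trans (ler_pM a0 b0 iN im) _.
  rewrite le_eqVlt; apply/orP; left; apply/eqP.
  by field; rewrite !gt_eqF.
apply: le_trans (lerD t1 (lerD t2 t3)) _.
have : 0 < k%:R^-1 :> R by rewrite invr_gt0.
by rewrite invfM; lra.
Qed.

(** The popular cluster is sampled, so a seed exists; its cluster is sampled at least as often and
    so is heavy. A low point of that cluster is sampled too, and the seed costs no more than it. *)
Lemma seed_penalty_ge1 S os : {subset S <= X} -> uncovered_spec cl C S RC.1 os ->
  seed_penalty S < 1 -> exists2 s, os = Some s & good_seed s.
Proof.
move=> SX us pen.
have e0 := eps_gt0; have k1 := kR_ge1; have N0 := N_gt0; have Q0 := Qp_gt0.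
have W0 := W_gt0.
have kgt0 : 0 < k%:R :> R by lra.
have A0 : 0 <= 4 / (N%:R * Q p) ^+ 2 * (cnt p S - N%:R * Q p) ^+ 2.
  by rewrite mulr_ge0 ?divr_ge0 ?sqr_ge0.
have B0 j : 0 <= (gap ^+ 2)^-1 * (cnt j S - N%:R * Q j) ^+ 2.
  by rewrite mulr_ge0 ?invr_ge0 ?sqr_ge0.
have D0 j : 0 <= ((N%:R * mass C (low j)) ^+ 2)^-1 *
    (cntlow j S - N%:R * mass C (low j)) ^+ 2.
  by rewrite mulr_ge0 ?invr_ge0 ?sqr_ge0.
have BS0 : 0 <= \sum_(j | ~~ heavy j) (gap ^+ 2)^-1 * (cnt j S - N%:R * Q j) ^+ 2.
  by apply: sumr_ge0.
have DS0 : 0 <= \sum_(j | heavy j && (j \notin map cl RC.1))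
     ((N%:R * mass C (low j)) ^+ 2)^-1 * (cntlow j S - N%:R * mass C (low j)) ^+ 2.
  by apply: sumr_ge0.
have cp : N%:R * Q p / 2 < cnt p S.
  rewrite ltNge; apply/negP => le.
  have : 1 <= 4 / (N%:R * Q p) ^+ 2 * (cnt p S - N%:R * Q p) ^+ 2.
    have M0 : 0 < N%:R * Q p by rewrite mulr_gt0.
    rewrite mulrAC ler_pdivlMr ?exprn_gt0 // mul1r.
    have c0 : 0 <= cnt p S by rewrite ler0n.
    by move: (N%:R * Q p) le M0 => M *; nra.
  by move: pen; rewrite /seed_penalty; lra.
have cp0 : 0 < cnt p S.
  by apply: le_lt_trans cp; apply: divr_ge0 => //; apply: mulr_ge0; exact: ltW.
case: os us => [s|] /=; last first.
  move=> allR; move: cp0; rewrite ltr0n -has_count => /hasP[x xS /eqP xp].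
  by move: pR; rewrite -xp allR.
case=> s_S sR smax smin; exists s => //.
have cs : N%:R * Q p / 2 < cnt (cl s) S.
  by apply: lt_le_trans cp _; rewrite ler_nat smax.
have hs : heavy (cl s).
  apply/negP => /negP; rewrite -ltNge -(ltr_pM2l N0) => light.
  have g0 : 0 < gap by rewrite mulr_gt0 // divr_gt0 // mulr_gt0.
  have far : gap <= cnt (cl s) S - N%:R * Q (cl s).
    have := popular; rewrite -/(Q p) -(ler_pM2l N0) => pp.
    have E1 : N%:R * (5 * eps / (16 * k%:R)) = 10 * gap.
      by rewrite /gap; field; rewrite gt_eqF.
    have E2 : N%:R * (eps / (8 * k%:R)) = 4 * gap.
      by rewrite /gap; field; rewrite gt_eqF.
    by rewrite E1 in pp; rewrite E2 in light; lra.
  have : 1 <= (gap ^+ 2)^-1 * (cnt (cl s) S - N%:R * Q (cl s)) ^+ 2.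
    rewrite mulrC ler_pdivlMr ?exprn_gt0 // mul1r.
    by rewrite ler_pXn2r ?nnegrE ?(le_trans (ltW g0) far) ?(ltW g0).
  have : (gap ^+ 2)^-1 * (cnt (cl s) S - N%:R * Q (cl s)) ^+ 2 <=
      \sum_(j | ~~ heavy j) (gap ^+ 2)^-1 * (cnt j S - N%:R * Q j) ^+ 2.
    rewrite [leRHS](bigD1 (cl s)) /= ?lerDl; first exact: sumr_ge0.
    by rewrite /heavy -ltNge -(ltr_pM2l N0).
  by move: pen; rewrite /seed_penalty; lra.
have : 0 < cntlow (cl s) S.
  rewrite ltNge; apply/negP => le.
  have c0 : cntlow (cl s) S = 0 by apply/eqP; rewrite eq_le le ler0n.
  have m0 : 0 < mass C (low (cl s)).
    by apply: lt_le_trans (heavy_low hs sR); exact: heavy_low_gt0.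
  have : ((N%:R * mass C (low (cl s))) ^+ 2)^-1 *
     (cntlow (cl s) S - N%:R * mass C (low (cl s))) ^+ 2 = 1.
    by rewrite c0 sub0r sqrrN mulVf // expf_neq0 // gt_eqF // mulr_gt0.
  have : ((N%:R * mass C (low (cl s))) ^+ 2)^-1 *
      (cntlow (cl s) S - N%:R * mass C (low (cl s))) ^+ 2 <=
    \sum_(j | heavy j && (j \notin map cl RC.1))
     ((N%:R * mass C (low j)) ^+ 2)^-1 * (cntlow j S - N%:R * mass C (low j)) ^+ 2.
    rewrite [leRHS](bigD1 (cl s)) ?hs ?sR //= lerDl; exact: sumr_ge0.
  by move: pen; rewrite /seed_penalty; lra.
rewrite ltr0n -has_count => /hasP[x xS /andP[/eqP xs lowx]].
split=> //; first exact: SX.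
- by move: hs; rewrite /heavy /Q ler_pdivlMr.
- by apply: le_trans lowx; rewrite ler_wpM2l ?csize_ge0 // smin.
Qed.

End Seed.

(** [f] will be the indicator of the invariant. It dominates 1 minus the penalty: on success it is
    1, and otherwise that bound is at most 0. *)
Lemma thinning_success (f : seq point * seq point -> R) s : good_seed s ->
  (forall a, 0 <= f a) ->
  (forall c, close c (cl s) -> f (rcons RC.1 s, rcons C c) = 1) ->
  1 - 5 / (16 * k%:R) <= expect f
    (let* T := uniform_sample k eps X C s in
     let* few := Tick (size T) (scal R d ((size T)%:R < constM k eps)) in
     if few then Ret RC
     else let* c := centroidM T in Ret (rcons RC.1 s, rcons C c)).
Proof.
move=> seed f0 f1; rewrite expect_bind.
have v := spec_valid (spec_uniform_sample cl d_gt0 n_gt0 k_gt0 sX eps_gt0 s sC).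
apply: (@le_trans _ _ (expect (fun T => 1 + -1 * thinning_penalty s T)
  (uniform_sample k eps X C s))).
  rewrite expectD expectZ (expect_cst _ v).
  by have := thinning_penalty_mean seed; lra.
apply: (expect_le v) => T [sT TX].
have [] := pselect (constM k eps <= (size T)%:R /\ close (mean T) (cl s)).
- case=> sM cT; rewrite /= ltNge sM /= expect_bind.
  rewrite (expect_det _ (spec_valid (spec_centroidM cl sT))) /= f1 //.
  by have := thinning_penalty_ge0 s T; lra.
- move=> /(thinning_penalty_ge1 seed TX) pen; apply: (@le_trans _ _ 0); first by lra.
  rewrite /=; case: ifP => _; first exact: f0.
  rewrite expect_bind (expect_det _ (spec_valid (spec_centroidM cl sT))).
  exact: f0.
Qed.

(** The failure bounds 3 / (16 k) for the seed and 5 / (16 k) for the sample add up to 1 / (2 k). *)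
Lemma step_success (f : seq point * seq point -> R) V : uniq (map cl RC.1) ->
  valid same V (step RC) -> (forall a, 0 <= f a) ->
  (forall s c, good_seed s -> close c (cl s) -> f (rcons RC.1 s, rcons C c) = 1) ->
  1 - 1 / (2 * k%:R) <= expect f (step RC).
Proof.
move=> uR vstep f0 f1; have [p pR popular] := exists_popular_cluster.
have k1 := kR_ge1; have ik : 0 < k%:R^-1 :> R by rewrite invr_gt0; lra.
have vS := spec_valid (spec_d2samples cl d_gt0 k_gt0 N sX n_gt0 sC).
rewrite /kmeans_step expect_bind.
apply: (@le_trans _ _ (expect (fun S => 1 - 5 / (16 * k%:R) + -1 * seed_penalty p S)
  (d2samples X C N))).
  rewrite expectD expectZ (expect_cst _ vS).
  by have := seed_penalty_mean popular; rewrite !invfM; lra.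
apply: (expect_le (valid_and vS (valid_bind_inv vstep))) => S [[sS SX] vu].
rewrite expect_bind.
have us := spec_valid (spec_uncovered_cluster d_gt0 k_gt0 sS sC uR).
rewrite -(expect_cst (1 - 5 / (16 * k%:R) + -1 * seed_penalty p S) us).
apply: (expect_le (valid_and us (valid_bind_inv vu))) => os [osP vos].
have [lt1|ge1] := ltP (seed_penalty p S) 1; last first.
  apply: (@le_trans _ _ 0); last exact: (expect_ge0 vos).
  by rewrite invfM; lra.
have [s -> seed] := seed_penalty_ge1 pR popular SX osP lt1.
apply: le_trans (thinning_success seed f0 (fun c => f1 s c seed)).
by have := seed_penalty_ge0 p S; lra.
Qed.

End GoodSeed.

(** * The invariant along the k iterations *)

Definition invariant (i : nat) (RC : seq point * seq point) : Prop :=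
  wf_state cl i RC /\
  ((Phi RC.2 X <= (1 + eps)%:E * Delta k X)%E \/ good_state RC /\ size RC.1 = i).

Lemma Phi_rcons (C : seq point) c : (Phi (rcons C c) X <= Phi C X)%E.
Proof.
apply: lee_sum => y _; elim: C => [|c' C IH] /=; first by rewrite big_nil leey.
by rewrite !big_cons le_min !ge_min lexx IH !orbT.
Qed.

(** Once the target cost is reached it persists, because centers are only added. Otherwise an
    iteration must cover a new cluster; skipping counts as failure, whence the exact count in
    [invariant]. *)
Lemma step_invariant i RC : (i < k)%N -> invariant i RC ->
  1 - 1 / (2 * k%:R) <=
  expect (fun RC' => (`[< invariant i.+1 RC' >])%:R) (step RC).
Proof.
move=> ik [wf st]; have k1 := kR_ge1.
have v := spec_valid (spec_kmeans_step d_gt0 n_gt0 k_gt0 sX eps_gt0 (ltnW ik) wf).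
have [done|bad] := boolP (Phi RC.2 X <= (1 + eps)%:E * Delta k X)%E.
  apply: (@le_trans _ _ 1).
    by rewrite lerBlDr lerDl divr_ge0 // mulr_ge0 // ler0n.
  rewrite -[leLHS](expect_cst 1 v); apply: (expect_le v) => RC' [wf' ext].
  suff -> : `[< invariant i.+1 RC' >] by [].
  apply/asboolP; split=> //; left.
  case: ext => [->//|[c ->]]; exact: le_trans (Phi_rcons _ _) done.
have [good sz] : good_state RC /\ size RC.1 = i by case: st => // h; rewrite h in bad.
have [sR sC uR] := wf.
apply: (step_success (leq_trans sC (ltnW ik)) good bad uR v) => [a|s c seed cs].
  exact: ler0n.
suff -> : `[< invariant i.+1 (rcons RC.1 s, rcons RC.2 c) >] by [].
case: seed => s_X s_R _ _; apply/asboolP; split.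
  by split; rewrite /= ?size_rcons ?map_rcons ?rcons_uniq ?s_R.
right; rewrite /= size_rcons sz; split=> //; case: good => RX good1 good2; split=> /=.
- by move=> x; rewrite mem_rcons inE => /orP[/eqP->|/RX].
- move=> c'; rewrite mem_rcons inE map_rcons => /orP[/eqP->|/good1[j jR cj]].
    by exists (cl s); rewrite ?mem_rcons ?mem_head.
  by exists j; rewrite // mem_rcons inE jR orbT.
- move=> j; rewrite map_rcons mem_rcons inE => /orP[/eqP->|/good2[c' c'C cj]].
    by exists c; rewrite ?mem_rcons ?mem_head.
  by exists c'; rewrite // mem_rcons inE c'C orbT.
Qed.

Lemma invariant_success RC : invariant k RC ->
  (Phi RC.2 X <= (1 + eps)%:E * Delta k X)%E.
Proof.
case=> [[_ _ uR]] [//|[good sz]]; apply: (all_covered k_gt0 eps_gt0 opt good) => j.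
(* k distinct labels exhaust ['I_k], so every cluster is covered. *)
have /subset_cardP/(_ (subset_predT _)) -> // : #|map cl RC.1| = #|'I_k|.
by rewrite (card_uniqP uR) size_map sz card_ord.
Qed.

(** The union bound, as an induction that loses 1 / (2 k) per iteration. Where the invariant breaks,
    the required bound is at most 0 and nonnegativity of the remaining expectation is enough. *)
Lemma iter_success m i RC : (i + m = k)%N -> invariant i RC ->
  1 - m%:R * (1 / (2 * k%:R)) <=
  expect (fun RC' => (Phi RC'.2 X <= (1 + eps)%:E * Delta k X)%E%:R)
    (Defs.iterM m step RC).
Proof.
elim: m i RC => [|m IH] i RC imk inv.
  rewrite addn0 in imk; rewrite /= mul0r subr0 invariant_success //.
  by rewrite -[X in invariant X]imk.
have ik : (i < k)%N by rewrite -imk addnS ltnS leq_addr.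
have v := spec_valid (spec_kmeans_step d_gt0 n_gt0 k_gt0 sX eps_gt0 (ltnW ik) inv.1).
have k1 := kR_ge1; have d0 : 0 <= 1 / (2 * k%:R) :> R.
  by rewrite divr_ge0 // mulr_ge0 // ler0n.
rewrite /= expect_bind.
apply: (@le_trans _ _ (expect (fun RC' => (`[< invariant i.+1 RC' >])%:R +
    - (m%:R * (1 / (2 * k%:R)))) (step RC))).
  rewrite expectD (expect_cst _ v) -natr1.
  by have := step_invariant ik inv; lra.
apply: (expect_le v) => RC' [wf' _].
case: asboolP => [inv'|_] /=; first by apply: (IH i.+1) => //; rewrite addSnnS.
apply: (@le_trans _ _ 0); first by rewrite add0r oppr_le0 mulr_ge0 ?ler0n.
have vit : valid same (fun=> True) (Defs.iterM m step RC').
  apply: valid_imp (spec_valid (_ : spec same (wf_state cl (i.+1 + m)) _ _ _)) => //.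
  apply: (spec_iterM (I := fun l => wf_state cl (i.+1 + l))); last by rewrite addn0.
  move=> l RC'' lm wfl; rewrite addnS.
  have lk : (i.+1 + l <= k)%N by rewrite -imk addSnnS leq_add2l ltnW.
  have := spec_kmeans_step d_gt0 n_gt0 k_gt0 sX eps_gt0 lk wfl.
  by move=> /spec_weaken; apply=> // ? [].
by apply: (expect_ge0 vit) => a; exact: ler0n.
Qed.

Lemma query_kmeans_success :
  1 / 4 <= prob same (fun C => (Phi C X <= (1 + eps)%:E * Delta k X)%E)
    (query_kmeans X k eps).
Proof.
rewrite prob_expect expect_bind.
have inv0 : invariant 0 ([::], [::]) by split=> //; right.
apply: le_trans (iter_success (add0n k) inv0).
have k1 := kR_ge1.
(* The k iterations together lose 1 / 2, which leaves more than the required 1 / 4. *)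
have -> : k%:R * (1 / (2 * k%:R)) = 1 / 2 :> R by field; rewrite gt_eqF //; lra.
by lra.
Qed.

End SuccessProbability.

Theorem theorem9 (R : realType) :
  exists Kt Kq : R,
  forall (d n k : nat) (eps : R) (X : n.-tuple 'rV[R]_d)
         (cl : 'rV[R]_d -> 'I_k),
    (0 < d)%N -> (0 < n)%N -> (0 < k)%N ->
    0 < eps <= 1 / 2 ->
    uniq X ->
    irreducible k eps X ->
    optimal_clustering X cl ->
    [/\ (runtime (same_cluster cl) (query_kmeans X k eps))%:R
          <= Kt * (n%:R * d%:R * k%:R ^+ 5 / eps ^+ 4),
        1 / 4 <= prob (same_cluster cl)
                   (fun C => (Phi C X <= (1 + eps)%:E * Delta k X)%E)
                   (query_kmeans X k eps)
      & (queries (same_cluster cl) (query_kmeans X k eps))%:R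
          <= Kq * (k%:R ^+ 5 / eps ^+ 4)].
Proof.
exists (2 ^+ 34), (2 ^+ 25) => d n k eps X cl d_gt0 n_gt0 k_gt0 /andP[eps_gt0 eps_le].
move=> _ irr opt; have sX : size X = n by rewrite size_tuple.
split.
- exact: runtime_query_kmeans.
- exact: (query_kmeans_success d_gt0 n_gt0 k_gt0 sX eps_gt0 eps_le irr opt).
- exact: (queries_query_kmeans cl d_gt0 n_gt0 k_gt0 sX eps_gt0 eps_le).
Qed.
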